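(* Let $X$ be a sparse $2\times n$ matrix (in the normal form given in the context) and let $I$ be the ideal of $2\times 2$ minors of $X$. Let $\tau$ be a diagonal term order on $R=K[X]$ and let $\tau'$ be its extension to $R[t]$. Then $$\mathrm{in}_{\tau'}(\mathcal{R}(I))=\mathcal{R}(\mathrm{in}_\tau(I))\quad\text{and}\quad \mathrm{reltype}(I)\le 2.$$ Moreover, the set $\{x_{1i},x_{2j}\mid 1\le i\le r+s,\ r+1\le j\le n\}\cup\{f_{ij}t\mid 1\le i<j\le n\}$ is a SAGBI basis of $\mathcal{R}(I)$ with respect to $\tau'$.
   Context: $K$ is a field, $n\ge3$. A sparse matrix is a matrix whose entries are either zero or distinct indeterminates over $K$. Up to permuting rows and columns, it is assumed that there are integers $r,s$ with $r\ge1$, $s\ge 0$, $0\le n-r-s\le r<n$ such that $$X=\begin{pmatrix}x_{1,1}&\cdots&x_{1,r}&x_{1,r+1}&\cdots&x_{1,r+s}&0&\cdots&0\\0&\cdots&0&x_{2,r+1}&\cdots&x_{2,r+s}&x_{2,r+s+1}&\cdots&x_{2,n}\end{pmatrix}.$$ $R=K[X]$ is the polynomial ring over $K$ in the variables appearing in $X$; $f_{ij}$ is the $2\times2$ minor on columns $i<j$, and $I=(f_{ij}\mid 1\le i<j\le n)$. A diagonal term order on $R$ is a term order for which the leading term of each nonzero minor of $X$ is the product of the entries on its diagonal (so $f_{ij}\neq0$, $i<j$, has leading term $x_{1i}x_{2j}$). The extension $\tau'$ of $\tau$ to $R[t]$: for monomials $a,b\in R$ and $i,j\ge0$, $at^i<_{\tau'}bt^j$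 iff $i<j$, or $i=j$ and $a<_\tau b$. The Rees algebra of an ideal $H\subseteq R$ is $\mathcal{R}(H)=\bigoplus_{i\ge0}H^it^i\subseteq R[t]$. For a $K$-subalgebra $A\subseteq R[t]$, $\mathrm{in}_{\tau'}(A)$ is the $K$-algebra generated by the initial monomials of all nonzero elements of $A$; a subset $C\subseteq A$ is a SAGBI basis of $A$ if $\mathrm{in}_{\tau'}(A)$ is generated as a $K$-algebra by the initial monomials of the nonzero elements of $C$. The relation type $\mathrm{reltype}(H)$ is the largest $y$-degree of a minimal generator of the kernel of the $R$-algebra map $R[y_1,\dots,y_m]\to\mathcal{R}(H)$, $y_i\mapsto h_it$, where $h_1,\dots,h_m$ is a minimal generating set of $H$. *)

(* Defs.v *)
From HB Require Import structures.
From mathcomp Require Import all_boot all_order all_algebra.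
From mathcomp Require Export mpoly.
Set Implicit Arguments.
Unset Strict Implicit.
Unset Printing Implicit Defensive.
Import GRing.Theory.
Local Open Scope ring_scope.

(* Ideals, subalgebras and other subsets of a ring [A] are predicates
   [A -> Prop]. *)

Section Ideals.
Variable A : comNzRingType.

Definition ideal_gen (S : A -> Prop) (p : A) : Prop :=
  exists2 s : seq (A * A), forall c, c \in s -> S c.2
                         & p = \sum_(c <- s) c.1 * c.2.

(* For [i = 0] the empty product is 1, so [ideal_pow H 0] is all of [A]. *)
Definition ideal_pow (H : A -> Prop) (i : nat) : A -> Prop :=
  ideal_gen (fun q => exists2 u : 'I_i -> A, forall k, H (u k)
                                           & q = \prod_(k < i) u k).

(* The Rees algebra, as a subset of A[t]; the indeterminate t is ['X]. *)
Definition rees (H : A -> Prop) (p : {poly A}) : Prop :=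
  forall i, ideal_pow H i p`_i.

Definition minimal_generators (H : A -> Prop) m (h : 'I_m -> A) : Prop :=
  (forall p, H p <-> ideal_gen (fun q => exists k, q = h k) p) /\
  (forall k, ~ ideal_gen (fun q => exists2 l, l != k & q = h l) (h k)).

(* The A-algebra map A[y_1, ..., y_m] -> A[t] sending y_i to h_i t. *)
Definition rees_map m (h : 'I_m -> A) (F : {mpoly A[m]}) : {poly A} :=
  mmap (@polyC A) (fun i => h i *: 'X) F.

End Ideals.

(* [d] is the y-degree of a member of some minimal generating set of the kernel
   of [rees_map h], for some minimal generating set [h] of [H].  That kernel is
   graded by y-degree, and its generators are taken homogeneous: without this
   their degrees could be arbitrarily large. *)
Definition relation_degree (A : comNzRingType) (H : A -> Prop) (d : nat) : Prop :=
  exists m (h : 'I_m -> A), minimal_generators H h /\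
  exists l (g : 'I_l -> {mpoly A[m]}),
    [/\ minimal_generators (fun F => rees_map h F = 0) g,
        forall k, exists e, g k \is e.-homog
      & exists k, g k \is d.-homog].

(* No [d] qualifies when there are no relations at all, that
   is, when the set of degrees is empty. *)
Definition is_reltype (A : comNzRingType) (H : A -> Prop) (d : nat) : Prop :=
  relation_degree H d /\ forall e, relation_degree H e -> (e <= d)%N.

Section TermOrders.
Variables (K : fieldType) (N : nat).
Implicit Types (le : rel 'X_{1..N}).

Definition term_order le : Prop :=
  [/\ total le, antisymmetric le, transitive le,
      forall m, le 0%MM m
    & forall m1 m2 m, le m1 m2 -> le (m1 + m)%MM (m2 + m)%MM].

Definition is_lead le (p : {mpoly K[N]}) (m : 'X_{1..N}) : Prop :=
  m \in msupp p /\ forall m', m' \in msupp p -> le m' m.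

Definition initial_ideal le (H : {mpoly K[N]} -> Prop) : {mpoly K[N]} -> Prop :=
  ideal_gen (fun q => exists p m, [/\ H p, is_lead le p m & q = 'X_[m]]).

(* The monomial x^m t^i of R[t], R = K[x_1, ..., x_N], is the pair [(m, i)]. *)
Definition ext_order le : rel ('X_{1..N} * nat) :=
  fun a b => (a.2 < b.2)%N || (a.2 == b.2) && le a.1 b.1.

Definition in_supp (p : {poly {mpoly K[N]}}) (a : 'X_{1..N} * nat) : Prop :=
  p`_(a.2)@_(a.1) != 0.

Definition is_lead_ext le (p : {poly {mpoly K[N]}}) (a : 'X_{1..N} * nat) : Prop :=
  in_supp p a /\ forall b, in_supp p b -> ext_order le b a.

Definition initial_monomials le (C : {poly {mpoly K[N]}} -> Prop)
    (q : {poly {mpoly K[N]}}) : Prop :=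
  exists (p : {poly {mpoly K[N]}}) a, [/\ C p, is_lead_ext le p a & q = 'X_[a.1] *: 'X^(a.2)].

Inductive alg_gen (S : {poly {mpoly K[N]}} -> Prop) : {poly {mpoly K[N]}} -> Prop :=
| alg_gen_const (c : K) : alg_gen S (c%:MP)%:P
| alg_gen_in p : S p -> alg_gen S p
| alg_gen_add p q : alg_gen S p -> alg_gen S q -> alg_gen S (p + q)
| alg_gen_mul p q : alg_gen S p -> alg_gen S q -> alg_gen S (p * q).

Definition initial_algebra le (A : {poly {mpoly K[N]}} -> Prop) :=
  alg_gen (initial_monomials le A).

Definition sagbi_basis le (A C : {poly {mpoly K[N]}} -> Prop) : Prop :=
  (forall p, C p -> A p) /\
  (forall p, initial_algebra le A p <-> alg_gen (initial_monomials le C) p).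

(* All minors, of every size [k]; [f] and [g] select the rows and columns. *)
Definition diagonal_order n (X : 'M[{mpoly K[N]}]_(2, n)) le : Prop :=
  forall k (f : 'I_k -> 'I_2) (g : 'I_k -> 'I_n),
    (forall a b : 'I_k, (a < b)%N -> (f a < f b)%N) ->
    (forall a b : 'I_k, (a < b)%N -> (g a < g b)%N) ->
    \det (mxsub f g X) != 0 ->
    exists2 m, is_lead le (\det (mxsub f g X)) m
             & (\det (mxsub f g X))@_m *: 'X_[m] = \prod_(a < k) X (f a) (g a).

End TermOrders.

(* Columns are numbered from 0: the first row has the r + s variables x_{1,j},
   j < r + s, and the second row has the n - r variables x_{2,j}, r <= j < n.
   The former come first in the numbering of the indeterminates of R = K[X]. *)
Definition sparse_vars (n r s : nat) : nat := (r + s) + (n - r).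

Definition sparse_var (n r s : nat) (i : 'I_2) (j : 'I_n) :
    option 'I_(sparse_vars n r s) :=
  if i == 0 then omap (@lshift (r + s) (n - r)) (insub (val j))
  else if (r <= j)%N then omap (@rshift (r + s) (n - r)) (insub (j - r)%N)
  else None.

Definition sparse_mx (K : fieldType) (n r s : nat) :
    'M[{mpoly K[sparse_vars n r s]}]_(2, n) :=
  \matrix_(i < 2, j < n)
    (if sparse_var r s i j is Some k then 'X_k else 0).

Section SparseMinors.
Variables (K : fieldType) (n r s : nat).
Local Notation X := (sparse_mx K n r s).

Definition sparse_minor (i j : 'I_n) : {mpoly K[sparse_vars n r s]} :=
  \det (colsub (fun b : 'I_2 => if b == 0 then i else j) X).

Definition minors_ideal : {mpoly K[sparse_vars n r s]} -> Prop :=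
  ideal_gen (fun q => exists i j : 'I_n, (i < j)%N /\ q = sparse_minor i j).

Definition sparse_sagbi (q : {poly {mpoly K[sparse_vars n r s]}}) : Prop :=
  [\/ exists2 i : 'I_n, (i < r + s)%N & q = (X 0 i)%:P,
      exists2 j : 'I_n, (r <= j)%N & q = (X 1 j)%:P
    | exists i j : 'I_n, (i < j)%N /\ q = sparse_minor i j *: 'X].

End SparseMinors.

Arguments sparse_minor : clear implicits.
Arguments minors_ideal : clear implicits.
Arguments sparse_sagbi : clear implicits.

(* Main.v *)
(* The idea is a straightening law.  In R[y], with one variable y_kl for each
   nonzero minor f_kl, the relations
     x_ci y_kl - x_ck y_il + x_cl y_ik = 0               (c = 1, 2, i < k < l)
     y_ik y_lj - y_il y_kj + y_ij y_kl = 0               (i < k < l < j)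
   rewrite every monomial as a combination of standard ones: those in which every
   x_1i satisfies i >= k and every x_2j satisfies j <= l, for all y_kl present,
   and in which the pairs (k, l) of the y_kl present form a chain for the
   componentwise order.  Substituting x_1k x_2l t, the leading monomial of f_kl t,
   for y_kl is injective on standard monomials: the y_kl must use the smallest
   column indices of the first row and the largest ones of the second row, matched
   in increasing order.  So the images of the standard monomials in R[t] have
   distinct leading monomials.  It follows that the relations above generate the
   kernel of the presentation of the Rees algebra, and that the leading monomial
   of any element of the Rees algebra is that of the image of a standard monomial,
   a product of variables x_v and monomials x_1k x_2l t. *)

Require Import Defs.
From mathcomp Require Import all_boot all_order all_algebra.
From mathcomp Require Import ring zify.
From Stdlib Require Import Classical_Prop.
Set Implicit Arguments.
Unset Strict Implicit.
Unset Printing Implicit Defensive.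
Import GRing.Theory.
Local Open Scope ring_scope.

(** * Ideals *)

Section IdealGen.
Variable A : comNzRingType.
Implicit Types (S T H : A -> Prop) (p q : A).

Lemma mem_ideal_gen S p : S p -> ideal_gen S p.
Proof.
move=> Sp; exists [:: (1, p)]; last by rewrite big_seq1 mul1r.
by move=> c; rewrite inE => /eqP->.
Qed.

Lemma ideal_gen0 S : ideal_gen S 0.
Proof. by exists [::]; rewrite ?big_nil. Qed.

Lemma ideal_genD S p q : ideal_gen S p -> ideal_gen S q -> ideal_gen S (p + q).
Proof.
move=> [s Ss ->] [t St ->]; exists (s ++ t); last by rewrite big_cat.
by move=> c; rewrite mem_cat => /orP[/Ss|/St].
Qed.

Lemma ideal_genMl S a p : ideal_gen S p -> ideal_gen S (a * p).
Proof.
move=> [s Ss ->]; exists [seq (a * c.1, c.2) | c <- s].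
  by move=> _ /mapP[c /Ss Sc ->].
by rewrite big_map mulr_sumr; apply: eq_bigr => c _; rewrite mulrA.
Qed.

Lemma ideal_gen_sum S (I : Type) (r : seq I) (P : pred I) (F : I -> A) :
  (forall i, P i -> ideal_gen S (F i)) -> ideal_gen S (\sum_(i <- r | P i) F i).
Proof. by move=> SF; apply: big_ind => //; [apply: ideal_gen0 | apply: ideal_genD]. Qed.

Lemma ideal_gen_ind S (P : A -> Prop) :
    P 0 -> (forall p q, P p -> P q -> P (p + q)) ->
    (forall a p, S p -> P (a * p)) ->
  forall p, ideal_gen S p -> P p.
Proof.
move=> P0 PD PM p [s Ss ->]; rewrite big_seq.
by apply: big_ind => // c /Ss; apply: PM.
Qed.

Lemma ideal_gen_sub S T :
  (forall p, S p -> ideal_gen T p) -> forall p, ideal_gen S p -> ideal_gen T p.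
Proof.
move=> ST; apply: (ideal_gen_ind (P := ideal_gen T)); first exact: ideal_gen0.
  exact: ideal_genD.
by move=> a p /ST; apply: ideal_genMl.
Qed.

Lemma ideal_gen_mulB S p p' q q' :
  ideal_gen S (p - p') -> ideal_gen S (q - q') -> ideal_gen S (p * q - p' * q').
Proof.
move=> Sp Sq; have ->: p * q - p' * q' = p * (q - q') + q' * (p - p').
  by rewrite !mulrBr [q' * p]mulrC [q' * p']mulrC addrA subrK.
by apply: ideal_genD; apply: ideal_genMl.
Qed.

Lemma ideal_gen_fam l (g : 'I_l -> A) p :
  ideal_gen (fun q => exists k, q = g k) p -> exists a : 'I_l -> A, p = \sum_k a k * g k.
Proof.
apply: (ideal_gen_ind (P := fun p => exists a : 'I_l -> A, p = \sum_k a k * g k)).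
- by exists (fun=> 0); rewrite big1 // => k _; rewrite mul0r.
- move=> _ _ [a ->] [b ->]; exists (fun k => a k + b k).
  by rewrite -big_split; apply: eq_bigr => k _; rewrite mulrDl.
- move=> a _ [k ->]; exists (fun j => if j == k then a else 0).
  rewrite (bigD1 k) //= eqxx big1 ?addr0 // => j /negPf->.
  by rewrite mul0r.
Qed.

(** Redundant generators are discarded one at a time, by induction on their number; [lift k]
    re-indexes the family without its [k]-th member. *)
Lemma minimal_subfamily H l (g : 'I_l -> A) :
  (forall p, H p <-> ideal_gen (fun q => exists k, q = g k) p) ->
  exists l' (f : 'I_l' -> 'I_l), minimal_generators H (g \o f).
Proof.
elim: l g => [|l IHl] g gH; first by exists 0%N, id; split=> // -[].
have [[k Hk]|noK] := classic
    (exists k, ideal_gen (fun q => exists2 l, l != k & q = g l) (g k)); last first.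
  by exists l.+1, id; split=> // k Hk; apply: noK; exists k.
case: (IHl (g \o lift k)) => [p|l' [f Hf]]; last by exists l', (lift k \o f).
rewrite gH; split; apply: ideal_gen_sub => _ [j ->]; last first.
  by apply: mem_ideal_gen; exists (lift k j).
case: (unliftP k j) => [i ->|->]; first by apply: mem_ideal_gen; exists i.
move: Hk; apply: ideal_gen_sub => _ [i i_k ->].
apply: mem_ideal_gen; case: (unliftP k i) => [i' ->|]; first by exists i'.
by move/eqP; rewrite (negPf i_k).
Qed.

End IdealGen.

(** * The relation type *)

Section Substitution.
Variable A : comNzRingType.
Implicit Types m : nat.

Lemma rees_map_comp m m' (h : 'I_m -> A) (h' : 'I_m' -> A)
    (t : m'.-tuple {mpoly A[m]}) F :
    (forall j, rees_map h (tnth t j) = h' j *: 'X) ->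
  rees_map h (F \mPo t) = rees_map h' F.
Proof.
move=> ht; rewrite /rees_map comp_mpolyE rmorph_sum.
rewrite [in RHS]/mmap; apply: eq_bigr => u _.
rewrite /= mmapZ rmorph_prod; congr (_ * _); apply: eq_bigr => i _.
by rewrite rmorphXn -ht.
Qed.

Lemma dhomog_comp m m' (t : m'.-tuple {mpoly A[m]}) d F :
    (forall j, tnth t j \is 1.-homog) -> F \is d.-homog ->
  F \mPo t \is d.-homog.
Proof.
move=> t1 /dhomogP Fd; rewrite comp_mpolyE big_seq; apply: rpred_sum => u /Fd ud.
apply: rpredZ; rewrite -ud /= mdegE.
apply: (big_rec2 (fun (e : nat) (q : {mpoly A[m]}) => q \is e.-homog)).
  exact: dhomog1.
move=> i e q _ qe; apply: dhomogM => //.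
by have := dhomogMn (u i) (t1 i); rewrite mul1n.
Qed.

(** Modulo the relations ['X_j = tnth t j], the substitution fixes every variable, and congruences
    pass through products, powers and sums. *)
Lemma sub_comp_mpoly m (t : m.-tuple {mpoly A[m]}) F :
  ideal_gen (fun q => exists j, q = 'X_j - tnth t j) (F - (F \mPo t)).
Proof.
rewrite {1}[F]mpolyE comp_mpolyE -sumrB; apply: ideal_gen_sum => u _.
rewrite -scalerBr -mul_mpolyC; apply: ideal_genMl; rewrite mpolyXE_id.
set S := fun _ => _.
apply: (big_ind2 (fun p q => ideal_gen S (p - q))).
- by rewrite subrr; apply: ideal_gen0.
- by move=> *; apply: ideal_gen_mulB.
move=> i _; elim: (u i) => [|n IHn]; first by rewrite subrr; apply: ideal_gen0.
rewrite !exprS; apply: ideal_gen_mulB => //.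
by apply: mem_ideal_gen; exists i.
Qed.

End Substitution.

(** * Bounding the degrees of minimal relations *)

Section RelationType.
Variable A : comNzRingType.
Implicit Types (H : A -> Prop) (m d D : nat).

Definition low_relation D m (h : 'I_m -> A) (F : {mpoly A[m]}) : Prop :=
  rees_map h F = 0 /\ exists2 e, (e <= D)%N & F \is e.-homog.

(** The coefficients that express [h' j] through [h] are those of the linear form; this is the
    change of variables between two presentations of the Rees algebra. *)
Lemma linear_tuple m m' (h : 'I_m -> A) (h' : 'I_m' -> A) :
    (forall j, ideal_gen (fun q => exists k, q = h k) (h' j)) ->
  exists t : m'.-tuple {mpoly A[m]}, (forall j, tnth t j \is 1.-homog) /\
    (forall j, rees_map h (tnth t j) = h' j *: 'X).
Proof.
move=> hh'; pose P (j : 'I_m') (q : {mpoly A[m]}) :=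
  q \is 1.-homog /\ rees_map h q = h' j *: 'X.
suff /fin_all_exists[T TP]: forall j, exists q, P j q.
  by exists [tuple T j | j < m']; split=> j; rewrite tnth_mktuple; case: (TP j).
move=> j; have [a ha] := ideal_gen_fam (hh' j).
exists (\sum_k a k *: 'X_k); split.
  by apply: rpred_sum => k _; rewrite rpredZ // dhomogX /= mdeg1.
rewrite /rees_map rmorph_sum ha scaler_suml; apply: eq_bigr => k _.
by rewrite /= mmapZ mmapX mmap1U mul_polyC scalerA.
Qed.

(* Substituting one family of generators into the other identifies the two
   presentations up to the linear relations ['X_j - tnth t j]. *)
Lemma low_relation_transfer D m m' (h : 'I_m -> A) (h' : 'I_m' -> A) :
    (0 < D)%N ->
    (forall j, ideal_gen (fun q => exists k, q = h k) (h' j)) ->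
    (forall k, ideal_gen (fun q => exists j, q = h' j) (h k)) ->
    (forall F, rees_map h F = 0 -> ideal_gen (low_relation D h) F) ->
  forall F, rees_map h' F = 0 -> ideal_gen (low_relation D h') F.
Proof.
move=> D0 /linear_tuple[a [a1 ah]] /linear_tuple[b [b1 bh]] kerh F F0.
have ab (G : {mpoly A[m']}) : (G \mPo a) \mPo b = G \mPo [tuple tnth a i \mPo b | i < m'].
  rewrite [G \mPo a]comp_mpolyE raddf_sum [RHS]comp_mpolyE.
  apply: eq_bigr => u _ /=; rewrite comp_mpolyZ rmorph_prod; congr (_ *: _).
  by apply: eq_bigr => i _; rewrite rmorphXn tnth_mktuple.
(* The difference of [F] and its double substitution lies in the ideal of linear relations, which
   are admissible because [0 < D]. The double substitution itself is the image under [b] of a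
   relation of [h]. *)
rewrite -[F](subrK ((F \mPo a) \mPo b)); apply: ideal_genD.
  rewrite ab; move: (sub_comp_mpoly [tuple tnth a i \mPo b | i < m'] F).
  apply: ideal_gen_sub => _ [j ->]; apply: mem_ideal_gen; split.
    rewrite /rees_map rmorphB /= -!/(rees_map _ _) tnth_mktuple.
    by rewrite (rees_map_comp _ bh) ah {1}/rees_map mmapX mmap1U subrr.
  exists 1%N => //; apply: rpredB; first by rewrite dhomogX /= mdeg1.
  by rewrite tnth_mktuple; apply: dhomog_comp.
have /kerh : rees_map h (F \mPo a) = 0 by rewrite (rees_map_comp _ ah).
apply: (ideal_gen_ind (P := fun G => ideal_gen _ (G \mPo b))).
- by rewrite comp_mpoly0; apply: ideal_gen0.
- by move=> p q Hp Hq; rewrite comp_mpolyD; apply: ideal_genD.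
move=> c p [p0 [e eD pe]]; rewrite rmorphM; apply/ideal_genMl/mem_ideal_gen.
split; first by rewrite (rees_map_comp _ bh).
by exists e => //; apply: dhomog_comp.
Qed.

(** Only the component of [c] of degree [d - e] contributes, and there is none when [d < e]. *)
Lemma pihomog_mul m d e (c g : {mpoly A[m]}) : g \is e.-homog ->
  exists2 c', pihomog mdeg d (c * g) = c' * g & (d < e)%N -> c' = 0.
Proof.
move=> ge; have cE := pihomog_partitionE (leqnn (mmeasure mdeg c)).
exists (\sum_(i < mmeasure mdeg c | (i + e)%N == d) pihomog mdeg i c).
  rewrite {1}cE mulr_suml raddf_sum mulr_suml [RHS]big_mkcond.
  apply: eq_bigr => i _; have ci := dhomogM (pihomogP mdeg i c) ge.
  case: eqP => [<-|/eqP ne]; first exact: pihomog_dE.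
  exact: pihomog_ne0 ne ci.
move=> de; rewrite big1 // => i /eqP ie.
by move: de; rewrite -ie ltnNge leq_addl.
Qed.

(** A homogeneous generator [g k] of degree above [D] would be redundant. It lies in the ideal of
    the relations of degree at most [D]. Each of these is a combination of the [g j], and comparing
    components of its own degree removes the term in [g k]. *)
Lemma relation_degree_le H D m (h : 'I_m -> A) :
    (0 < D)%N ->
    (forall p, H p <-> ideal_gen (fun q => exists k, q = h k) p) ->
    (forall F, rees_map h F = 0 -> ideal_gen (low_relation D h) F) ->
  forall d, relation_degree H d -> (d <= D)%N.
Proof.
move=> D0 hH kerh d [m' [h' [[h'H _] [l [g [[gker gmin] ghom [k gkd]]]]]]].
rewrite leqNgt; apply/negP => Dd; apply: (gmin k).
have {}kerh : forall F, rees_map h' F = 0 -> ideal_gen (low_relation D h') F.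
  apply: low_relation_transfer kerh => // j.
    by apply/hH/h'H/mem_ideal_gen; exists j.
  by apply/h'H/hH/mem_ideal_gen; exists j.
have /kerh : rees_map h' (g k) = 0 by apply/gker/mem_ideal_gen; exists k.
apply: ideal_gen_sub => F [/gker/ideal_gen_fam[c cF] [e eD Fe]].
rewrite -(pihomog_dE Fe) cF raddf_sum /=; apply: ideal_gen_sum => j _.
have [->|jk] := eqVneq j k.
  have [c' -> ->] := pihomog_mul e (c k) gkd; last exact: leq_ltn_trans eD Dd.
  by rewrite mul0r; apply: ideal_gen0.
have [e' gje] := ghom j; have [c' -> _] := pihomog_mul e (c j) gje.
by apply/ideal_genMl/mem_ideal_gen; exists j.
Qed.

Lemma ex_max_bounded (P : nat -> Prop) D :
    (exists d, P d) -> (forall d, P d -> (d <= D)%N) ->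
  exists2 d, P d & forall e, P e -> (e <= d)%N.
Proof.
elim: D => [|D IHD] [d0 Pd0] PD; first by exists d0 => // e /PD; rewrite leqn0 => /eqP->.
have [PSD|nPSD] := classic (P D.+1); first by exists D.+1.
apply: IHD; first by exists d0.
move=> d Pd; have := PD d Pd; rewrite leq_eqVlt => /predU1P[dE|//].
by case: nPSD; rewrite -dE.
Qed.

Lemma is_reltype_le H D m (h : 'I_m -> A) l (g : 'I_l -> {mpoly A[m]}) :
    (0 < D)%N -> minimal_generators H h ->
    (forall F, rees_map h F = 0 <-> ideal_gen (fun q => exists k, q = g k) F) ->
    (forall k, exists2 e, (e <= D)%N & g k \is e.-homog) ->
    (exists2 F, rees_map h F = 0 & F != 0) ->
  exists2 d, is_reltype H d & (d <= D)%N.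
Proof.
move=> D0 hmin kerg ghom [F F0 nzF].
have bound : forall d, relation_degree H d -> (d <= D)%N.
  apply: (relation_degree_le (h := h)) => //; first by case: hmin.
  move=> G /kerg; apply: ideal_gen_sub => _ [k ->]; apply: mem_ideal_gen.
  by split; last exact: ghom; apply/kerg/mem_ideal_gen; exists k.
have [l' [f fmin]] := minimal_subfamily kerg.
(* An empty generating family would make the kernel zero, contrary to [F]; so the set of relation
   degrees is not empty and has a maximum. *)
have [k0 _] : exists k : 'I_l', True.
  apply: NNPP => noK; case/eqP: nzF; have /ideal_gen_fam[c ->] := (fmin.1 F).1 F0.
  by rewrite big1 // => k; case: noK; exists k.
have [e _ ge] := ghom (f k0).
have degH : relation_degree H e.
  exists m, h; split=> //; exists l', (g \o f); split=> //; last by exists k0.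
  by move=> k; have [e' _ ?] := ghom (f k); exists e'.
have [d dH dmax] := ex_max_bounded (ex_intro _ e degH) bound.
by exists d; [split | apply: bound].
Qed.

End RelationType.

(** * Rees algebras and leading monomials *)

Section Rees.
Variable A : comNzRingType.
Implicit Types (H S : A -> Prop) (p q : {poly A}).

Lemma ideal_pow0 H a : ideal_pow H 0 a.
Proof.
rewrite -[a]mulr1; apply/ideal_genMl/mem_ideal_gen.
by exists (fun=> 0); [case | rewrite big_ord0].
Qed.

Lemma ideal_pow1 H a : H a -> ideal_pow H 1 a.
Proof. by move=> Ha; apply: mem_ideal_gen; exists (fun=> a); rewrite ?big_ord1. Qed.

Lemma ideal_powM H i j a b :
  ideal_pow H i a -> ideal_pow H j b -> ideal_pow H (i + j) (a * b).
Proof.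
move=> Ha Hb; move: a Ha.
apply: (ideal_gen_ind (P := fun a => ideal_pow H (i + j) (a * b))).
- by rewrite mul0r; apply: ideal_gen0.
- by move=> a a' Ha Ha'; rewrite mulrDl; apply: ideal_genD.
move=> c _ [u Hu ->]; rewrite -mulrA; apply: ideal_genMl; move: b Hb.
apply: (ideal_gen_ind (P := fun b => ideal_pow H (i + j) (_ * b))).
- by rewrite mulr0; apply: ideal_gen0.
- by move=> b b' Hb Hb'; rewrite mulrDr; apply: ideal_genD.
move=> d _ [v Hv ->]; rewrite mulrCA; apply/ideal_genMl/mem_ideal_gen.
exists (fun k => match split k with inl k' => u k' | inr k' => v k' end).
  by move=> k; case: split.
rewrite big_split_ord; congr (_ * _); apply: eq_bigr => k _.
  by rewrite -[lshift _ _]/(unsplit (inl k)) unsplitK.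
by rewrite -[rshift _ _]/(unsplit (inr k)) unsplitK.
Qed.

Lemma reesD H p q : rees H p -> rees H q -> rees H (p + q).
Proof. by move=> Hp Hq i; rewrite coefD; apply: ideal_genD; [apply: Hp | apply: Hq]. Qed.

Lemma reesM H p q : rees H p -> rees H q -> rees H (p * q).
Proof.
move=> Hp Hq i; rewrite coefM; apply: ideal_gen_sum => j _.
by have := ideal_powM (Hp j) (Hq (i - j)%N); rewrite subnKC ?leq_ord.
Qed.

Lemma reesC H a : rees H a%:P.
Proof.
by case=> [|i]; rewrite coefC; [apply: ideal_pow0 | apply: ideal_gen0].
Qed.

Lemma rees_genX H a : H a -> rees H (a *: 'X).
Proof.
move=> Ha i; rewrite coefZ coefX.
case: eqP => [->|_]; last by rewrite mulr0; apply: ideal_gen0.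
by rewrite mulr1; apply: ideal_pow1.
Qed.

Lemma rees_ind S (P : {poly A} -> Prop) :
    (forall a, P a%:P) -> (forall s, S s -> P (s *: 'X)) ->
    (forall p q, P p -> P q -> P (p + q)) ->
    (forall p q, P p -> P q -> P (p * q)) ->
  forall p, rees (ideal_gen S) p -> P p.
Proof.
move=> PC PX PD PM p Sp; have P0 : P 0 by have := PC 0; rewrite polyC0.
have P1 : P 1 by rewrite -polyC1; apply: PC.
have PH a : ideal_gen S a -> P (a *: 'X).
  apply: (ideal_gen_ind (P := fun a => P (a *: 'X))).
  - by rewrite scale0r.
  - by move=> *; rewrite scalerDl; apply: PD.
  by move=> c s Ss; rewrite -scalerA -mul_polyC; apply: PM; [apply: PC | apply: PX].
rewrite -[p]coefK poly_def; apply: big_ind => // i _; move: (p`_i) (Sp i) => a.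
apply: (ideal_gen_ind (P := fun a => P (a *: 'X^i))).
- by rewrite scale0r.
- by move=> *; rewrite scalerDl; apply: PD.
move=> c _ [u Su ->]; rewrite -scalerA -mul_polyC; apply: (PM) => //.
have -> : (\prod_(k < i) u k) *: 'X^i = \prod_(k < i) (u k *: 'X).
  clear Su; move: (i : nat) u => {}i u; elim: i u => [|i IHi] u.
    by rewrite !big_ord0 expr0 scale1r.
  by rewrite !big_ord_recl exprS -IHi -!mul_polyC polyCM mulrACA.
by apply: big_ind => // k _; apply: PH.
Qed.

End Rees.

(** * Leading monomials of products, and the extended order on [R[t]] *)

Section TermOrder.
Variables (K : fieldType) (N : nat) (le : rel 'X_{1..N}).
Hypothesis hle : term_order le.
Local Notation R := {mpoly K[N]}.
Implicit Types (a b : 'X_{1..N}) (p q : R).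

(** Fixing the leading coefficient to 1 lets the coefficient of a product at its top monomial be
    computed exactly. *)
Definition monic_lead p a : Prop := p@_a = 1 /\ forall b, p@_b != 0 -> le b a.

Lemma term_order_refl a : le a a.
Proof. by case: hle => le_total _ _ _ _; have := le_total a a; rewrite orbb. Qed.

Lemma term_orderD a a' b b' : le a a' -> le b b' -> le (a + b)%MM (a' + b')%MM.
Proof.
case: hle => _ _ le_trans _ leD ha hb; apply: (le_trans (a' + b)%MM); first exact: leD.
by rewrite ![(a' + _)%MM]addmC; apply: leD.
Qed.

(** Equality of the sums squeezes [a' + b] between them, and exponents cancel. Hence the top
    monomial of a product comes from a single pair of monomials. *)
Lemma term_orderD_eq a a' b b' :
  le a a' -> le b b' -> (a + b)%MM = (a' + b')%MM -> a = a' /\ b = b'.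
Proof.
case: hle => _ le_anti le_trans _ leD ha hb E.
have Ea : (a + b)%MM = (a' + b)%MM.
  apply: le_anti; rewrite leD //= E.
  by rewrite ![(a' + _)%MM]addmC; apply: leD.
by move: E; rewrite (addIm Ea) => /addmI->.
Qed.

Lemma monic_leadX a : monic_lead 'X_[a] a.
Proof.
split; first by rewrite mcoeffX eqxx.
move=> b; rewrite mcoeffX; have [<- _|_] := eqVneq a b; first exact: term_order_refl.
by rewrite eqxx.
Qed.

Lemma mcoeffM_msupp p q c :
  (p * q)@_c = \sum_(a <- msupp p) \sum_(b <- msupp q) p@_a * q@_b * ((a + b)%MM == c)%:R.
Proof.
rewrite {1}[p]mpolyE {1}[q]mpolyE mulr_suml raddf_sum; apply: eq_bigr => a _ /=.
rewrite mulr_sumr raddf_sum; apply: eq_bigr => b _ /=.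
by rewrite -scalerAl -scalerAr scalerA mcoeffZ -mpolyXD mcoeffX.
Qed.

Lemma monic_leadM p q a b :
  monic_lead p a -> monic_lead q b -> monic_lead (p * q) (a + b)%MM.
Proof.
move=> [pa lepa] [qb leqb]; split.
  have ap : a \in msupp p by rewrite mcoeff_msupp pa oner_eq0.
  have bq : b \in msupp q by rewrite mcoeff_msupp qb oner_eq0.
  have coef0 a' b' : a' \in msupp p -> b' \in msupp q -> (a' != a) || (b' != b) ->
      p@_a' * q@_b' * ((a' + b')%MM == (a + b)%MM)%:R = 0.
    rewrite !mcoeff_msupp => /lepa a'a /leqb b'b ne.
    case: eqP => [/(term_orderD_eq a'a b'b)[Ea Eb]|_]; last by rewrite mulr0.
    by rewrite Ea Eb !eqxx in ne.
  rewrite mcoeffM_msupp (bigD1_seq a) ?msupp_uniq //= (bigD1_seq b) ?msupp_uniq //=.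
  rewrite big_seq_cond big1 => [|b' /andP[b'q ne]]; last first.
    by rewrite coef0 // ne orbT.
  rewrite pa qb eqxx !mulr1 addr0 big_seq_cond big1 ?addr0 // => a' /andP[a'p ne].
  by rewrite big_seq big1 // => b' b'q; rewrite coef0 // ne.
move=> c; rewrite -mcoeff_msupp => /msuppM_le/allpairsP[[a' b'] /= [a'p b'q ->]].
by rewrite !mcoeff_msupp in a'p b'q; apply: term_orderD; [apply: lepa | apply: leqb].
Qed.

Lemma monic_lead1 : monic_lead 1 0%MM.
Proof. by rewrite -mpolyX0; apply: monic_leadX. Qed.

Lemma monic_leadXn p a i : monic_lead p a -> monic_lead (p ^+ i) (a *+ i)%MM.
Proof.
move=> pa; elim: i => [|i IHi]; first exact: monic_lead1.
by rewrite exprS mulmS; apply: monic_leadM.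
Qed.

Lemma monic_lead_prod m (p : 'I_m -> R) (a : 'I_m -> 'X_{1..N}) :
    (forall k, monic_lead (p k) (a k)) ->
  monic_lead (\prod_k p k) (\big[mnm_add/0%MM]_k a k).
Proof.
move=> pa; apply: (big_ind2 (fun q b => monic_lead q b)) => //; first exact: monic_lead1.
by move=> p1 a1 p2 a2; apply: monic_leadM.
Qed.

Lemma monic_lead_is_lead p a : monic_lead p a -> is_lead le p a.
Proof.
move=> [pa lepa]; split; first by rewrite mcoeff_msupp pa oner_eq0.
by move=> b; rewrite mcoeff_msupp; apply: lepa.
Qed.

Implicit Types (x y z : 'X_{1..N} * nat).

Lemma ext_order_total x y : ext_order le x y || ext_order le y x.
Proof.
case: hle => le_total _ _ _ _; rewrite /ext_order.
by case: (ltngtP x.2 y.2) => //= _; apply: le_total.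
Qed.

Lemma ext_order_trans : transitive (ext_order le).
Proof.
case: hle => _ _ le_trans _ _ y x z; rewrite /ext_order.
case: (ltngtP x.2 y.2) => //= [xy|->].
  by case: (ltngtP y.2 z.2) => //= [yz|<-] _ _; rewrite ?(ltn_trans xy yz) ?xy.
by case: (ltngtP y.2 z.2) => //= _; apply: le_trans.
Qed.

Lemma ext_order_anti x y : ext_order le x y -> ext_order le y x -> x = y.
Proof.
case: hle => _ le_anti _ _ _; case: x y => [a i] [b j]; rewrite /ext_order /=.
by case: ltngtP => //= -> ab ba; congr (_, _); apply: le_anti; rewrite ab.
Qed.

Lemma is_lead_ext_uniq (p : {poly R}) x y :
  is_lead_ext le p x -> is_lead_ext le p y -> x = y.
Proof. by move=> [px lepx] [py lepy]; apply: ext_order_anti; [apply: lepy | apply: lepx]. Qed.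

Lemma is_lead_extC p a : is_lead le p a -> is_lead_ext le p%:P (a, 0%N).
Proof.
rewrite /is_lead mcoeff_msupp => -[pa lepa]; split; first by rewrite /in_supp /= coefC eqxx.
move=> [b i]; rewrite /in_supp /ext_order /= coefC.
case: i => [|i] /=; last by rewrite mcoeff0 eqxx.
by rewrite -mcoeff_msupp => /lepa.
Qed.

Lemma is_lead_ext_scaleX p a : is_lead le p a -> is_lead_ext le (p *: 'X) (a, 1%N).
Proof.
rewrite /is_lead mcoeff_msupp => -[pa lepa]; split.
  by rewrite /in_supp /= coefZ coefX eqxx mulr1.
move=> [b i]; rewrite /in_supp /ext_order /= coefZ coefX.
have [->|_] := eqVneq i 1%N; last by rewrite mulr0 mcoeff0 eqxx.
by rewrite mulr1 -mcoeff_msupp => /lepa.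
Qed.

End TermOrder.

(** * Generated [K]-subalgebras of [R[t]] *)

Section Algebra.
Variables (K : fieldType) (N : nat).
Local Notation R := {mpoly K[N]}.
Implicit Types (S T : {poly R} -> Prop) (p q : {poly R}).

Lemma alg_gen_sub S T : (forall p, S p -> alg_gen T p) ->
  forall p, alg_gen S p -> alg_gen T p.
Proof.
move=> ST p; elim=> [c|q /ST //|? ? _ ? _ ?|? ? _ ? _ ?].
- exact: alg_gen_const.
- exact: alg_gen_add.
- exact: alg_gen_mul.
Qed.

Lemma alg_gen0 S : alg_gen S 0.
Proof. by have := alg_gen_const S 0; rewrite mpolyC0 polyC0. Qed.

Lemma alg_gen1 S : alg_gen S 1.
Proof. by have := alg_gen_const S 1; rewrite mpolyC1 polyC1. Qed.

Lemma alg_genX S p i : alg_gen S p -> alg_gen S (p ^+ i).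
Proof.
move=> Sp; elim: i => [|i IHi]; first exact: alg_gen1.
by rewrite exprS; apply: alg_gen_mul.
Qed.

Lemma alg_gen_prod S (I : Type) (r : seq I) (F : I -> {poly R}) :
  (forall i, alg_gen S (F i)) -> alg_gen S (\prod_(i <- r) F i).
Proof. by move=> SF; apply: big_ind => //; [apply: alg_gen1 | apply: alg_gen_mul]. Qed.

Lemma alg_gen_sum S (I : Type) (r : seq I) (F : I -> {poly R}) :
  (forall i, alg_gen S (F i)) -> alg_gen S (\sum_(i <- r) F i).
Proof. by move=> SF; apply: big_ind => //; [apply: alg_gen0 | apply: alg_gen_add]. Qed.

Lemma alg_genC S (r : R) : (forall i, alg_gen S ('X_i : R)%:P) -> alg_gen S r%:P.
Proof.
move=> SX; rewrite [r]mpolyE rmorph_sum; apply: alg_gen_sum => a /=.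
rewrite -mul_mpolyC rmorphM; apply: alg_gen_mul; first exact: alg_gen_const.
rewrite mpolyXE_id rmorph_prod; apply: alg_gen_prod => i.
by rewrite rmorphXn /=; apply/alg_genX/SX.
Qed.

Lemma rees_alg_gen S (H : R -> Prop) :
  (forall p, S p -> rees H p) -> forall p, alg_gen S p -> rees H p.
Proof.
move=> SH p; elim=> [c|q /SH //|? ? _ ? _ ?|? ? _ ? _ ?].
- exact: reesC.
- exact: reesD.
- exact: reesM.
Qed.

End Algebra.

(** * Standard monomials and SAGBI bases *)

Lemma total_max (T : eqType) (r : rel T) (s : seq T) (x : T) :
    (forall y z, r y z || r z y) -> transitive r -> x \in s ->
  exists2 y, y \in s & forall z, z \in s -> r z y.
Proof.
move=> r_total r_trans; have r_refl y : r y y by have := r_total y y; rewrite orbb.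
elim: s x => // a s IHs x _; case: s IHs => [|b s] IHs.
  by exists a => [|z]; rewrite inE ?eqxx // => /eqP->.
have [y ys ymax] := IHs b (mem_head _ _).
case/orP: (r_total a y) => ay.
  exists y => [|z]; first by rewrite inE ys orbT.
  by rewrite inE => /predU1P[->|/ymax].
exists a => [|z]; first exact: mem_head.
by rewrite inE => /predU1P[->|/ymax/r_trans->].
Qed.

(** * Straightening for an abstract family of standard monomials *)

Section StandardMonomials.
Variables (K : fieldType) (N m : nat) (le : rel 'X_{1..N}).
Local Notation R := {mpoly K[N]}.
Local Notation mon := ('X_{1..N} * 'X_{1..m})%type.
Variables (h : 'I_m -> R) (e : 'I_m -> 'X_{1..N}).
Variables (std : mon -> Prop) (w : mon -> nat) (G : {mpoly R[m]} -> Prop).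
Implicit Types (x y : mon) (F Q : {mpoly R[m]}).

(** Exponent in x and degree in t of the monomial obtained from [x] by replacing each y-variable by
    the leading monomial of its image. *)
Definition lead_exp x : 'X_{1..N} * nat :=
  ((x.1 + \big[mnm_add/0]_k (e k *+ x.2 k))%MM, mdeg x.2).

Definition monomial x : {mpoly R[m]} := 'X_[x.1] *: 'X_[x.2].

Definition normal F : Prop := forall a u, F@_u@_a != 0 -> std (a, u).

Hypothesis hle : term_order le.
Hypothesis h_lead : forall k, monic_lead le (h k) (e k).
Hypothesis lead_exp_inj : forall x y, std x -> std y -> lead_exp x = lead_exp y -> x = y.
Hypothesis relG : forall F, G F -> rees_map h F = 0.
Hypothesis reduce : forall x, std x \/
  exists s : seq (K * mon), (forall c, c \in s -> (w c.2 < w x)%N) /\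
    ideal_gen G (monomial x - \sum_(c <- s) c.1%:MP *: monomial c.2).

Lemma normal0 : normal 0.
Proof. by move=> a u; rewrite !mcoeff0 eqxx. Qed.

Lemma normalD F Q : normal F -> normal Q -> normal (F + Q).
Proof.
move=> nF nQ a u; rewrite !mcoeffD => ne.
have [F0|/nF//] := eqVneq F@_u@_a 0.
by apply: nQ; move: ne; rewrite F0 add0r.
Qed.

Lemma normalZ (c : K) F : normal F -> normal (c%:MP *: F).
Proof.
move=> nF a u; rewrite mcoeffZ mcoeffCM => ne.
by apply: nF; apply: contra_neq ne => ->; rewrite mulr0.
Qed.

(** Strong induction on [w x]: each rewriting by [reduce] produces only monomials of smaller
    weight. *)
Lemma straighten_monomial x : exists2 Q, normal Q & ideal_gen G (monomial x - Q).
Proof.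
have [k] := ubnP (w x); elim: k x => // k IHk x; rewrite ltnS => wx.
case: (reduce x) => [stdx|[s [ws Gs]]].
  exists (monomial x); last by rewrite subrr; apply: ideal_gen0.
  move=> a u; rewrite /monomial mcoeffZ mcoeffX.
  have [<-|_] := eqVneq x.2 u; last by rewrite mulr0 mcoeff0 eqxx.
  rewrite mulr1 mcoeffX; have [<- _|_] := eqVneq x.1 a; last by rewrite eqxx.
  by case: (x) stdx.
suff [Q nQ GQ] : exists2 Q, normal Q &
    ideal_gen G (\sum_(c <- s) c.1%:MP *: monomial c.2 - Q).
  exists Q => //; rewrite -[monomial x](subrK (\sum_(c <- s) c.1%:MP *: monomial c.2)).
  by rewrite -addrA; apply: ideal_genD.
elim: s ws {Gs} => [|c s IHs] ws.
  by exists 0; [apply: normal0 | rewrite big_nil subrr; apply: ideal_gen0].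
have [d ds|Q nQ GQ] := IHs; first by apply: ws; rewrite inE ds orbT.
have [|Q' nQ' GQ'] := IHk c.2; first by apply: leq_trans wx; apply/ws/mem_head.
exists (c.1%:MP *: Q' + Q); first by apply: normalD => //; apply: normalZ.
rewrite big_cons opprD addrACA; apply: ideal_genD => //.
by rewrite -scalerBr -mul_mpolyC; apply: ideal_genMl.
Qed.

Lemma straighten F : exists2 Q, normal Q & ideal_gen G (F - Q).
Proof.
have sumP (I : eqType) (s : seq I) (f : I -> {mpoly R[m]}) :
    (forall i, exists2 Q, normal Q & ideal_gen G (f i - Q)) ->
    exists2 Q, normal Q & ideal_gen G (\sum_(i <- s) f i - Q).
  move=> fP; elim: s => [|i s [Q nQ GQ]].
    by exists 0; [apply: normal0 | rewrite big_nil subrr; apply: ideal_gen0].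
  have [Q' nQ' GQ'] := fP i; exists (Q' + Q); first exact: normalD.
  by rewrite big_cons opprD addrACA; apply: ideal_genD.
rewrite [F]mpolyE; apply: (sumP) => u; rewrite [F@_u]mpolyE scaler_suml; apply: sumP => a.
have [Q nQ GQ] := straighten_monomial (a, u).
exists ((F@_u@_a)%:MP *: Q); first exact: normalZ.
rewrite -[F@_u@_a *: _]mul_mpolyC -scalerA -scalerBr -(mul_mpolyC (_%:MP)); exact: ideal_genMl.
Qed.

Definition support F : seq mon := [seq (a, u) | u <- msupp F, a <- msupp F@_u].

Lemma mem_support F x : (x \in support F) = (F@_(x.2)@_(x.1) != 0).
Proof.
apply/allpairsPdep/idP => [[u [a [_ + ->]]]|]; first by rewrite mcoeff_msupp.
case: x => a u /= Fau; exists u, a; rewrite !mcoeff_msupp Fau; split=> //.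
by apply: contra_neq Fau => ->; rewrite mcoeff0.
Qed.

Lemma support_uniq F : uniq (support F).
Proof.
apply: allpairs_uniq_dep => [|u _|]; try exact: msupp_uniq.
by move=> [u a] [u' a'] _ _ /= [-> ->].
Qed.

Definition image_poly x : R := 'X_[x.1] * \prod_k h k ^+ x.2 k.

Lemma image_poly_lead x : monic_lead le (image_poly x) (lead_exp x).1.
Proof.
apply: monic_leadM => //; first exact: monic_leadX.
by apply: monic_lead_prod => // k; apply: monic_leadXn.
Qed.

Lemma coef_rees_map F i b : (rees_map h F)`_i@_b =
  \sum_(x <- support F) F@_(x.2)@_(x.1) * ((i == mdeg x.2)%:R * (image_poly x)@_b).
Proof.
rewrite big_allpairs_dep /= /rees_map /mmap coef_sum raddf_sum; apply: eq_bigr => u _ /=.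
have -> : mmap1 (fun k => h k *: 'X) u = (\prod_k h k ^+ u k) *: 'X^(mdeg u).
  rewrite /mmap1 mdegE -prodrXr -mul_polyC rmorph_prod -big_split.
  by apply: eq_bigr => k _; rewrite exprZn -mul_polyC.
rewrite coefCM coefZ coefXn mulrA {1}[F@_u]mpolyE mulr_suml mulr_suml raddf_sum.
apply: eq_bigr => a _; rewrite /= -!scalerAl mcoeffZ; congr (_ * _).
by rewrite /image_poly /=; case: eqP => _; rewrite ?mulr1 ?mul1r ?mulr0 ?mul0r ?mcoeff0.
Qed.

(** Take [x] in the support with the largest [lead_exp]. Since [lead_exp] is injective on standard
    monomials, no other term can cancel the leading monomial of the image of [x]. *)
Lemma lead_rees_map F : normal F -> F != 0 ->
  exists2 x, std x & is_lead_ext le (rees_map h F) (lead_exp x).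
Proof.
move=> nF nzF; have [x0 x0F] : exists x, x \in support F.
  apply: NNPP => noX; case/eqP: nzF; apply/mpolyP => u; apply/mpolyP => a.
  rewrite !mcoeff0; apply/eqP; apply: contra_notT noX => Fau.
  by exists (a, u); rewrite mem_support.
have supp_std x : x \in support F -> std x.
  by rewrite mem_support => /nF; case: x.
have [x xF xmax] := total_max (r := relpre lead_exp (ext_order le))
  (fun y z => ext_order_total hle _ _) (fun y x z => @ext_order_trans _ _ hle _ _ _) x0F.
exists x; first exact: supp_std.
split.
  rewrite /in_supp coef_rees_map (bigD1_seq x) ?support_uniq //= eqxx mul1r.
  rewrite (image_poly_lead x).1 mulr1 big_seq_cond big1 ?addr0 -?mem_support //.
  move=> y /andP[yF yx]; case: eqP => [xy|_]; last by rewrite mul0r mulr0.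
  (* If the image of [y] contains this monomial, then [lead_exp x] is at most [lead_exp y];
     maximality of [x] gives equality, hence [y = x]. *)
  have [->|/(image_poly_lead y).2 le_xy] := eqVneq (image_poly y)@_(lead_exp x).1 0.
    by rewrite !mulr0.
  case/eqP: yx; apply: lead_exp_inj; try exact: supp_std.
  apply: (ext_order_anti hle); first exact: xmax.
  by rewrite /ext_order [(lead_exp x).2]xy eqxx le_xy orbT.
move=> [b i]; rewrite /in_supp coef_rees_map /= => ne.
have [y yF] : exists2 y, y \in support F & (i == mdeg y.2)%:R * (image_poly y)@_b != 0.
  apply: NNPP => noY; case/eqP: ne; rewrite big_seq big1 // => y yF.
  apply/eqP; rewrite mulf_eq0; apply/orP; right.
  by apply: contra_notT noY => ?; exists y.
have [->|_] := eqVneq i (mdeg y.2); last by rewrite mul0r eqxx.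
rewrite mul1r => /(image_poly_lead y).2 le_by.
apply: (ext_order_trans hle) (xmax y yF).
by rewrite /ext_order /= eqxx le_by orbT.
Qed.

Lemma rees_map_ideal F : ideal_gen G F -> rees_map h F = 0.
Proof.
apply: (ideal_gen_ind (P := fun F => rees_map h F = 0)).
- by rewrite /rees_map mmap0.
- by rewrite /rees_map => F1 F2 F10 F20; rewrite mmapD F10 F20 addr0.
by move=> c F' /relG F'0; rewrite /rees_map rmorphM /= -/(rees_map h F') F'0 mulr0.
Qed.

Lemma straighten_map F :
  exists2 Q, normal Q & rees_map h F = rees_map h Q /\ ideal_gen G (F - Q).
Proof.
have [Q nQ GFQ] := straighten F; exists Q; first exact: nQ.
split; last exact: GFQ.
apply/eqP; rewrite -subr_eq0 /rees_map -mmapB.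
exact/eqP/rees_map_ideal.
Qed.

(** A nonzero normal form has a nonzero image, so the normal form of a relation is 0. *)
Lemma kernel_gen F : rees_map h F = 0 -> ideal_gen G F.
Proof.
have [Q nQ [-> GFQ]] := straighten_map F; have [Q0|nzQ] := eqVneq Q 0.
  by move: GFQ; rewrite Q0 subr0.
have [x _ [+ _]] := lead_rees_map nQ nzQ.
by move=> + Q0; rewrite /in_supp Q0 coef0 mcoeff0 eqxx.
Qed.

(** [F] and its normal form have the same image, so [lead_rees_map] applies. *)
Lemma lead_in_image F (y : 'X_{1..N} * nat) : is_lead_ext le (rees_map h F) y ->
  exists2 x, std x & y = lead_exp x.
Proof.
have [Q nQ [-> _]] := straighten_map F; have [->|nzQ] := eqVneq Q 0.
  by rewrite /rees_map mmap0 => -[]; rewrite /in_supp coef0 mcoeff0 eqxx.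
have [x stdx leadx] := lead_rees_map nQ nzQ; exists x => //.
exact: is_lead_ext_uniq leadx.
Qed.

End StandardMonomials.

Lemma det_mx22 (A : comNzRingType) (M : 'M[A]_2) :
  \det M = M 0 0 * M 1 1 - M 0 1 * M 1 0.
Proof.
rewrite (expand_det_row _ 0) !big_ord_recl big_ord0 /cofactor !det_mx11 !mxE /=.
rewrite expr0 expr1 !mul1r addr0 mulN1r mulrN.
by congr (_ * M _ _ - M _ _ * M _ _); apply/val_inj.
Qed.

(** * The sparse matrix *)

Lemma scaleX_linear_eq0 (A : comNzRingType) (a b c a' b' c' : A) :
  a * a' - b * b' + c * c' = 0 ->
  a%:P * (a' *: 'X) - b%:P * (b' *: 'X) + c%:P * (c' *: 'X) = 0.
Proof. by rewrite !mul_polyC !scalerA -scalerBl -scalerDl => ->; rewrite scale0r. Qed.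

Lemma scaleX_quadratic_eq0 (A : comNzRingType) (a b c a' b' c' : A) :
  a * a' - b * b' + c * c' = 0 ->
  (a *: 'X) * (a' *: 'X) - (b *: 'X) * (b' *: 'X) + (c *: 'X) * (c' *: 'X) = 0.
Proof.
move=> E; have mulX (d e : A) : (d *: 'X) * (e *: 'X) = (d * e) *: ('X * 'X).
  by rewrite -scalerAl -scalerAr scalerA.
by rewrite !mulX -scalerBl -scalerDl E scale0r.
Qed.

(** A three-term relation times a cofactor, read as a rewriting rule for its first term;
    [mul_alternating_last] does the same for its last term. *)
Lemma mul_alternating_fst (A : comNzRingType) (a b c d : A) :
  d * (a - b + c) = a * d - (b * d - c * d).
Proof. ring. Qed.

Lemma mul_alternating_last (A : comNzRingType) (a b c d : A) :
  d * (a - b + c) = c * d - (b * d - a * d).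
Proof. ring. Qed.

Lemma ord2P (c : 'I_2) : c = 0 \/ c = 1.
Proof. by case: c => -[|[|//]] c2; [left | right]; apply/val_inj. Qed.

Section Sparse.
Variables (K : fieldType) (n r s : nat).
Hypothesis hrs : (r + s <= n)%N.
Local Notation N := (sparse_vars n r s).
Local Notation R := {mpoly K[N]}.
Local Notation X := (sparse_mx K n r s).
Local Notation minor := (sparse_minor K n r s).
Implicit Types (i j k l : 'I_n) (c : 'I_2) (v : 'I_N).

Definition var_row v : 'I_2 := if split v is inl _ then 0 else 1.

Lemma var_col_subproof v : (match split v with inl i => i : nat | inr j => r + j end < n)%N.
Proof.
by case: (split v) => a; have := ltn_ord a; lia.
Qed.

Definition var_col v : 'I_n := Ordinal (var_col_subproof v).

Lemma sparse_varK v : sparse_var r s (var_row v) (var_col v) = Some v.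
Proof.
rewrite /sparse_var /var_row /= -[in RHS](splitK v).
case: (split v) => a /=; first by rewrite valK.
by rewrite leq_addr addKn valK.
Qed.

Lemma sparse_var_some c i v :
  sparse_var r s c i = Some v -> var_row v = c /\ var_col v = i.
Proof.
rewrite /sparse_var /var_row; have [->|->] /= := ord2P c.
  case: insubP => //= a _ ai [<-]; rewrite -[lshift _ _]/(unsplit (inl a)) unsplitK.
  by split=> //; apply/val_inj; rewrite /= -[lshift _ _]/(unsplit (inl a)) unsplitK.
case: leqP => // ri; case: insubP => //= a _ ai [<-].
rewrite -[rshift _ _]/(unsplit (inr a)) unsplitK; split=> //; apply/val_inj => /=.
by rewrite -[rshift _ _]/(unsplit (inr a)) unsplitK ai subnKC.
Qed.

Lemma sparse_var0 i : isSome (sparse_var r s 0 i) = (i < r + s)%N.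
Proof. by rewrite /sparse_var /=; case: insubP => [a -> _|/negPf->]. Qed.

Lemma sparse_var1 i : isSome (sparse_var r s 1 i) = (r <= i)%N.
Proof.
rewrite /sparse_var /=; case: leqP => // ri; case: insubP => //=.
by rewrite ltn_sub2r // (leq_ltn_trans ri).
Qed.

(** The value [0%MM] at a zero entry is a placeholder; [entryE] never reads it. *)
Definition entry_exp c i : 'X_{1..N} := oapp (@mnm1 N) 0%MM (sparse_var r s c i).

Lemma entryE c i : X c i = if sparse_var r s c i then 'X_[entry_exp c i] else 0.
Proof. by rewrite mxE /entry_exp; case: sparse_var. Qed.

Lemma entry_var v : X (var_row v) (var_col v) = 'X_v.
Proof. by rewrite mxE sparse_varK. Qed.

Lemma minorE i j : minor i j = X 0 i * X 1 j - X 0 j * X 1 i.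
Proof. by rewrite /sparse_minor det_mx22 !mxE. Qed.

Definition edge (p : 'I_n * 'I_n) : bool := [&& p.1 < p.2, p.1 < r + s & r <= p.2]%N.

Lemma entry0_eq0 i : (r + s <= i)%N -> X 0 i = 0.
Proof. by move=> ri; rewrite entryE sparse_var0 ltnNge ri. Qed.

Lemma entry1_eq0 i : (i < r)%N -> X 1 i = 0.
Proof. by move=> ir; rewrite entryE sparse_var1 leqNgt ir. Qed.

(** If [x_1i] is missing, so is [x_1j] with [i < j]; if [x_2j] is missing, so is [x_2i]. Either way
    a whole row of the minor is zero. *)
Lemma minor_eq0 i j : (i < j)%N -> ~~ edge (i, j) -> minor i j = 0.
Proof.
rewrite /edge minorE /= => ij; rewrite ij /= negb_and -leqNgt -ltnNge => /orP[i_rs|j_r].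
  by rewrite !entry0_eq0 ?mul0r ?subrr //; lia.
by rewrite !entry1_eq0 ?mulr0 ?subrr //; lia.
Qed.

(** * Presentation of the Rees algebra by the nonzero minors, and its relations *)

Definition edges := [set p | edge p].
Local Notation m := #|edges|.
Local Notation mon := ('X_{1..N} * 'X_{1..m})%type.
Local Notation monom := (@monomial K N m).
Implicit Types (p q : 'I_m) (x y : mon).

Definition src p : 'I_n := (enum_val p).1.
Definition tgt p : 'I_n := (enum_val p).2.

Lemma edgeP p : [/\ src p < tgt p, src p < r + s & r <= tgt p]%N.
Proof. by have := enum_valP p; rewrite inE => /and3P. Qed.

Lemma edge_inj p q : src p = src q -> tgt p = tgt q -> p = q.
Proof.
rewrite /src /tgt => E1 E2; apply: enum_val_inj.
by move: E1 E2; case: (enum_val p) (enum_val q) => [a b] [a' b'] /= -> ->.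
Qed.

Definition gen p : R := minor (src p) (tgt p).
Definition gen_exp p : 'X_{1..N} := (entry_exp 0%R (src p) + entry_exp 1%R (tgt p))%MM.

(* The variable y_ij; it is 0 when f_ij vanishes, so that the relations below need
   no case distinction. *)
Definition edge_var i j : {mpoly R[m]} :=
  if [pick p | (src p == i) && (tgt p == j)] is Some p then 'X_p else 0.

Variant edge_var_spec i j : {mpoly R[m]} -> Prop :=
| EdgeVar p of src p = i & tgt p = j : edge_var_spec i j 'X_p
| EdgeVar0 of ~~ edge (i, j) : edge_var_spec i j 0.

Lemma edge_varP i j : edge_var_spec i j (edge_var i j).
Proof.
rewrite /edge_var; case: pickP => [p /andP[/eqP pi /eqP pj]|no_p]; constructor=> //.
apply/negP => ij; have ij_in : (i, j) \in edges by rewrite inE.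
have := no_p (enum_rank_in ij_in (i, j)).
by rewrite /src /tgt enum_rankK_in // !eqxx.
Qed.

Lemma edge_var_src_tgt p : edge_var (src p) (tgt p) = 'X_p.
Proof.
case: edge_varP => [q sq tq|]; first by rewrite (edge_inj sq tq).
by case: (edgeP p) => st sr rt; rewrite /edge st sr rt.
Qed.

Lemma rees_map_edge_var i j : (i < j)%N -> rees_map gen (edge_var i j) = minor i j *: 'X.
Proof.
move=> ij; case: edge_varP => [p <- <-|/(minor_eq0 ij)->]; last first.
  by rewrite /rees_map mmap0 scale0r.
by rewrite /rees_map mmapX mmap1U.
Qed.

(* Expansion of a 3 x 3 determinant whose first two rows are those of X and whose
   last row repeats row c. *)
Definition linear_relation c i k l : {mpoly R[m]} :=
  X c i *: edge_var k l - X c k *: edge_var i l + X c l *: edge_var i k.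

Definition plucker_relation i k l j : {mpoly R[m]} :=
  edge_var i k * edge_var l j - edge_var i l * edge_var k j + edge_var i j * edge_var k l.

Local Notation relation_index := ('I_2 * 'I_n * 'I_n * 'I_n + 'I_n * 'I_n * 'I_n * 'I_n)%type.

(** Tuples that are not increasing give the relation 0, so that the family is indexed by a finite
    type and can be enumerated. *)
Definition relation (t : relation_index) : {mpoly R[m]} :=
  match t with
  | inl (c, i, k, l) => if (i < k < l)%N then linear_relation c i k l else 0
  | inr (i, k, l, j) => if (i < k < l)%N && (l < j)%N then plucker_relation i k l j else 0
  end.

Lemma rees_map_relation t : rees_map gen (relation t) = 0.
Proof.
case: t => [[[[c i] k] l]|[[[i k] l] j]] /=.
  case: ifP => [/andP[ik kl]|_]; last by rewrite /rees_map mmap0.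
  rewrite /rees_map mmapD mmapB !mmapZ -!/(rees_map _ _) !rees_map_edge_var //; last by lia.
  by rewrite !minorE; apply: scaleX_linear_eq0; case: (ord2P c) => ->; ring.
case: ifP => [/andP[/andP[ik kl] lj]|_]; last by rewrite /rees_map mmap0.
rewrite /rees_map mmapD mmapB !rmorphM /= -!/(rees_map _ _) !rees_map_edge_var //; try lia.
by rewrite !minorE; apply: scaleX_quadratic_eq0; ring.
Qed.

Lemma relation_homog t : exists2 e, (e <= 2)%N & relation t \is e.-homog.
Proof.
have X1 i j : edge_var i j \is 1.-homog.
  by case: edge_varP => [p _ _|_]; rewrite ?dhomog0 // dhomogX /= mdeg1.
case: t => [[[[c i] k] l]|[[[i k] l] j]] /=.
  exists 1%N => //; case: ifP => _; rewrite ?dhomog0 // /linear_relation.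
  by apply: rpredD; [apply: rpredB|]; apply: dhomogZ.
exists 2 => //; case: ifP => _; rewrite ?dhomog0 //.
by apply: rpredD; [apply: rpredB|]; apply: (@dhomogM _ _ _ 1 _ 1).
Qed.

(* A weight that strictly decreases when the relations are used as rewriting rules:
   [edge_weight] is convex in [j - i], which takes care of the Pluecker relations,
   and [2 * n] exceeds the change of [edge_weight] per unit shift of one index. *)
Definition var_weight c (i : nat) : nat :=
  if c == 0 then (2 * n * (n - i))%N else (2 * n * i)%N.
Definition edge_weight (i j : nat) : nat := ((j - i) ^ 2)%N.

Definition weight x : nat :=
  (\sum_v x.1 v * var_weight (var_row v) (var_col v)
   + \sum_p x.2 p * edge_weight (src p) (tgt p))%N.

(** The right-hand sides that the hypothesis [reduce] allows, as a predicate closed under sums and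
    opposites. *)
Definition combination (b : nat) (F : {mpoly R[m]}) : Prop :=
  exists2 t : seq (K * mon), forall d, d \in t -> (weight d.2 < b)%N
                           & F = \sum_(d <- t) d.1%:MP *: monom d.2.

Lemma combination0 b : combination b 0.
Proof. by exists [::]; rewrite ?big_nil. Qed.

Lemma combinationD b F F' :
  combination b F -> combination b F' -> combination b (F + F').
Proof.
move=> [t tb ->] [t' tb' ->]; exists (t ++ t'); last by rewrite big_cat.
by move=> d; rewrite mem_cat => /orP[/tb|/tb'].
Qed.

Lemma combinationN b F : combination b F -> combination b (- F).
Proof.
move=> [t tb ->]; exists [seq (- d.1, d.2) | d <- t].
  by move=> _ /mapP[d /tb db ->].
by rewrite big_map -sumrN; apply: eq_bigr => d _; rewrite mpolyCN scaleNr.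
Qed.

Lemma combination_monomial b x : (weight x < b)%N -> combination b (monom x).
Proof.
move=> xb; exists [:: (1, x)]; last by rewrite big_seq1 mpolyC1 scale1r.
by move=> d; rewrite inE => /eqP->.
Qed.

Lemma monomialM x y :
  monom x * monom y = monom ((x.1 + y.1)%MM, (x.2 + y.2)%MM).
Proof. by rewrite /monomial !mpolyXD -scalerAl -scalerAr scalerA. Qed.

Lemma weightD x y : weight ((x.1 + y.1)%MM, (x.2 + y.2)%MM) = (weight x + weight y)%N.
Proof.
rewrite /weight /= addnACA -!big_split.
by congr (_ + _)%N; apply: eq_bigr => v _; rewrite mnmDE mulnDl.
Qed.

Lemma weight1 v : weight (U_(v)%MM, 0%MM) = var_weight (var_row v) (var_col v).
Proof.
rewrite /weight /= [X in (_ + X)%N]big1 => [|p _]; last by rewrite mnm0E.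
rewrite addn0 (bigD1 v) //= big1 => [|u /negPf uv]; last by rewrite mnm1E eq_sym uv.
by rewrite mnm1E eqxx mul1n addn0.
Qed.

Lemma weight2 p : weight (0%MM, U_(p)%MM) = edge_weight (src p) (tgt p).
Proof.
rewrite /weight /= big1 => [|v _]; last by rewrite mnm0E.
rewrite (bigD1 p) //= big1 => [|u /negPf up]; last by rewrite mnm1E eq_sym up.
by rewrite mnm1E eqxx mul1n addn0.
Qed.

(** A zero entry or a vanishing minor makes the whole term 0, so a bound in terms of the column
    indices alone suffices. *)
Lemma combination_linear b c i j l x :
    (var_weight c i + edge_weight j l + weight x < b)%N ->
  combination b (X c i *: edge_var j l * monom x).
Proof.
rewrite entryE /entry_exp; case Ev: (sparse_var r s c i) => [v|] /=; last first.
  by rewrite scale0r mul0r => _; apply: combination0.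
have [<- <-] := sparse_var_some Ev; case: edge_varP => [p <- <-|_]; last first.
  by rewrite scaler0 mul0r => _; apply: combination0.
rewrite -weight1 -weight2 -weightD /= addm0 add0m -weightD => wb.
by rewrite -[_ *: _]/(monom (U_(v)%MM, U_(p)%MM)) monomialM; apply: combination_monomial.
Qed.

Lemma combination_quadratic b i j k l x :
    (edge_weight i j + edge_weight k l + weight x < b)%N ->
  combination b (edge_var i j * edge_var k l * monom x).
Proof.
case: edge_varP => [p <- <-|_]; last by rewrite !mul0r => _; apply: combination0.
case: edge_varP => [q <- <-|_]; last by rewrite mulr0 mul0r => _; apply: combination0.
rewrite -!weight2 -!weightD /= add0m => wb.
rewrite -mpolyXD -[X in X * _]scale1r -mpolyX0.
by rewrite -[_ *: _]/(monom (0%MM, (U_(p) + U_(q))%MM)) monomialM /=; apply: combination_monomial.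
Qed.

(** * Standard monomials and the rewriting rules *)

Definition compatible v p : bool :=
  if var_row v == 0 then (src p <= var_col v)%N else (var_col v <= tgt p)%N.

(** The first clause excludes the products that the linear relations rewrite, the second those that
    the Pluecker relations rewrite. Pairs with equal sources are always comparable, so the second
    clause describes a chain. *)
Definition standard x : Prop :=
  (forall v p, (0 < x.1 v)%N -> (0 < x.2 p)%N -> compatible v p) /\
  (forall p q, (0 < x.2 p)%N -> (0 < x.2 q)%N -> (src p < src q)%N -> (tgt p <= tgt q)%N).

Lemma standardP x :
  [\/ standard x,
      exists v p, [/\ (0 < x.1 v)%N, (0 < x.2 p)%N & ~~ compatible v p]
    | exists p q, [/\ (0 < x.2 p)%N, (0 < x.2 q)%N, (src p < src q)%N & (tgt q < tgt p)%N]].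
Proof.
have [H1|H1] := classic (exists v p, [/\ (0 < x.1 v)%N, (0 < x.2 p)%N & ~~ compatible v p]).
  by apply: Or32.
have [H2|H2] := classic (exists p q,
    [/\ (0 < x.2 p)%N, (0 < x.2 q)%N, (src p < src q)%N & (tgt q < tgt p)%N]).
  by apply: Or33.
apply: Or31; split=> [v p v0 p0|p q p0 q0 pq].
  by apply: contra_notT H1 => ?; exists v, p.
by rewrite leqNgt; apply/negP => qp; apply: H2; exists p, q.
Qed.

Lemma mnm_decomp (d : nat) (u : 'X_{1..d}) (a : 'I_d) : (0 < u a)%N -> u = (U_(a) + (u - U_(a)))%MM.
Proof. by move=> ua; rewrite addmC submK // lep1mP -lt0n. Qed.

(** Moving the matrix variable by [d] columns lowers [var_weight] by [2 * n * d], while the two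
    squares differ by [d] times a factor smaller than [2 * n]. The first two inequalities serve the
    first row, the others the second. *)
Lemma weight_ineqs (i k l : nat) : (i < k)%N -> (k < l)%N -> (l < n)%N ->
  [/\ (var_weight 0%R k + edge_weight i l < var_weight 0%R i + edge_weight k l)%N,
      (var_weight 0%R l + edge_weight i k < var_weight 0%R i + edge_weight k l)%N,
      (var_weight 1%R k + edge_weight i l < var_weight 1%R l + edge_weight i k)%N
    & (var_weight 1%R i + edge_weight k l < var_weight 1%R l + edge_weight i k)%N].
Proof.
move=> ik kl ln; rewrite /var_weight /edge_weight /=.
(* Writing the gaps as successors removes truncated subtraction and leaves polynomial
   inequalities. *)
have [p E1]: exists p : nat, k = (i + p.+1)%N by exists (k - i).-1; lia.
have [q E2]: exists q : nat, l = (k + q.+1)%N by exists (l - k).-1; lia.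
have [t E3]: exists t : nat, n = (l + t.+1)%N by exists (n - l).-1; lia.
rewrite E3 E2 E1 -!addnA !addKn !expnS !expn0 !muln1.
by split; nia.
Qed.

(** With consecutive gaps a, b, c, the right side exceeds the left by 2ac in the first case and by
    2(b^2 + ab + bc + ac) in the second. *)
Lemma edge_weight_ineqs (i k l j : nat) : (i < k)%N -> (k < l)%N -> (l < j)%N ->
  (edge_weight i l + edge_weight k j < edge_weight i j + edge_weight k l)%N /\
  (edge_weight i k + edge_weight l j < edge_weight i j + edge_weight k l)%N.
Proof.
move=> ik kl lj; rewrite /edge_weight.
have [p E1]: exists p : nat, k = (i + p.+1)%N by exists (k - i).-1; lia.
have [q E2]: exists q : nat, l = (k + q.+1)%N by exists (l - k).-1; lia.
have [t E3]: exists t : nat, j = (l + t.+1)%N by exists (j - l).-1; lia.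
rewrite E3 E2 E1 -!addnA !addKn !expnS !expn0 !muln1.
by split; nia.
Qed.

(** A monomial that is not standard contains a forbidden product of two variables. The relation on
    the columns involved, times the cofactor [y], rewrites it into monomials of smaller weight. *)
Lemma reduction x : standard x \/
  exists t : seq (K * mon), (forall d, d \in t -> (weight d.2 < weight x)%N) /\
    ideal_gen (fun F => exists t, F = relation t)
      (monom x - \sum_(d <- t) d.1%:MP *: monom d.2).
Proof.
suff: standard x \/ exists2 F, combination (weight x) F &
    ideal_gen (fun F => exists t, F = relation t) (monom x - F).
  by case=> [|[_ [t wt ->] Gt]]; [left | right; exists t].
have [|[v [p [v0 p0 ip]]]|[p [q [p0 q0 pq qp]]]] := standardP x; first by left.
  right; have [st sr rt] := edgeP p.
  pose y : mon := ((x.1 - U_(v))%MM, (x.2 - U_(p))%MM).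
  have xE : x = ((U_(v) + y.1)%MM, (U_(p) + y.2)%MM).
    by rewrite /y /= -!mnm_decomp //; case: (x).
  have -> : weight x =
      (var_weight (var_row v) (var_col v) + edge_weight (src p) (tgt p) + weight y)%N.
    by rewrite xE -weight1 -weight2 -!weightD /= addm0 add0m.
  have -> : monom x = X (var_row v) (var_col v) *: edge_var (src p) (tgt p) * monom y.
    by rewrite entry_var edge_var_src_tgt -[_ *: _]/(monom (U_(v)%MM, U_(p)%MM)) monomialM xE.
  move: ip; rewrite /compatible; move: (var_row v) (var_col v) => c i.
  (* In the first row [i < src p < tgt p], and the first term of the linear relation is rewritten;
     in the second row [src p < tgt p < i], and the last term is. *)
  have [->|->] /= := ord2P c; rewrite -ltnNge => ip.
    have [w1 w2 _ _] := weight_ineqs ip st (ltn_ord _).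
    exists (X 0 (src p) *: edge_var i (tgt p) * monom y
            - X 0 (tgt p) *: edge_var i (src p) * monom y).
      apply: combinationD; [|apply: combinationN];
      by apply: combination_linear; rewrite ltn_add2r.
    apply: (eq_ind _ _ (ideal_genMl (monom y) (mem_ideal_gen _))).
      by exists (inl (0, i, src p, tgt p)).
    by rewrite /= ip st; apply: mul_alternating_fst.
  have [_ _ w1 w2] := weight_ineqs st ip (ltn_ord _).
  exists (X 1 (tgt p) *: edge_var (src p) i * monom y
          - X 1 (src p) *: edge_var (tgt p) i * monom y).
    apply: combinationD; [|apply: combinationN];
    by apply: combination_linear; rewrite ltn_add2r.
  apply: (eq_ind _ _ (ideal_genMl (monom y) (mem_ideal_gen _))).
    by exists (inl (1, src p, tgt p, i)).
  by rewrite /= ip st; apply: mul_alternating_last.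
(* The pairs are nested, [src p < src q < tgt q < tgt p], and their product is the last term of the
   Pluecker relation on these four columns. *)
right; have [st sr rt] := edgeP q.
pose y : mon := (x.1, (x.2 - U_(p) - U_(q))%MM).
have xE : x = (x.1, (U_(p) + U_(q) + y.2)%MM).
  rewrite /y /= -addmA -!mnm_decomp //; first by case: (x).
  rewrite mnmBE mnm1E; case: eqP => [pq'|_]; last by rewrite subn0.
  by rewrite pq' ltnn in pq.
have -> : weight x =
    (edge_weight (src p) (tgt p) + edge_weight (src q) (tgt q) + weight y)%N.
  by rewrite xE -!weight2 -!weightD /= !add0m.
have -> : monom x = edge_var (src p) (tgt p) * edge_var (src q) (tgt q) * monom y.
  rewrite !edge_var_src_tgt -mpolyXD -[X in X * _]scale1r -mpolyX0.
  by rewrite -[_ *: _]/(monom (0%MM, (U_(p) + U_(q))%MM)) monomialM /= add0m {1}xE.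
have [w1 w2] := edge_weight_ineqs pq st qp.
exists (edge_var (src p) (tgt q) * edge_var (src q) (tgt p) * monom y
        - edge_var (src p) (src q) * edge_var (tgt q) (tgt p) * monom y).
  apply: combinationD; [|apply: combinationN];
  by apply: combination_quadratic; rewrite ltn_add2r.
apply: (eq_ind _ _ (ideal_genMl (monom y) (mem_ideal_gen _))).
  by exists (inr (src p, src q, tgt q, tgt p)).
by rewrite /= pq st qp; apply: mul_alternating_last.
Qed.

(** * Recovering a standard monomial from its leading monomial *)

Definition endpoint c p : 'I_n := if c == 0 then src p else tgt p.

(** The degree in the row [c] variables whose column satisfies [P]. It is additive, and turns an
    equality of leading monomials into equalities of counts. *)
Definition exp_count c (P : pred 'I_n) (a : 'X_{1..N}) : nat :=
  \sum_(v | (var_row v == c) && P (var_col v)) a v.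

Lemma exp_count0 c P : exp_count c P 0%MM = 0%N.
Proof. by rewrite /exp_count big1 // => v _; rewrite mnm0E. Qed.

Lemma exp_countD c P : {morph exp_count c P : a b / (a + b)%MM >-> (a + b)%N}.
Proof.
by move=> a b; rewrite /exp_count -big_split; apply: eq_bigr => v _; rewrite mnmDE.
Qed.

Lemma exp_countMn c P a d : exp_count c P (a *+ d)%MM = (exp_count c P a * d)%N.
Proof.
by rewrite /exp_count big_distrl; apply: eq_bigr => v _; rewrite mulmnE.
Qed.

Lemma exp_count_entry c c' i P : sparse_var r s c' i ->
  exp_count c P (entry_exp c' i) = (c' == c) && P i.
Proof.
rewrite /entry_exp; case Ev: (sparse_var r s c' i) => [v|] //= _.
have [<- <-] := sparse_var_some Ev; rewrite /exp_count big_mkcond (bigD1 v) //=.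
rewrite mnm1E eqxx big1 ?addn0 => [|u uv]; first by case: ifP.
by case: ifP => // _; rewrite mnm1E eq_sym (negPf uv).
Qed.

Lemma sparse_var_src p : sparse_var r s 0 (src p).
Proof. by rewrite sparse_var0; case: (edgeP p). Qed.

Lemma sparse_var_tgt p : sparse_var r s 1 (tgt p).
Proof. by rewrite sparse_var1; case: (edgeP p). Qed.

Lemma exp_count_gen c P p : exp_count c P (gen_exp p) = P (endpoint c p).
Proof.
rewrite /gen_exp exp_countD !exp_count_entry ?sparse_var_src ?sparse_var_tgt // /endpoint.
by have [->|->] := ord2P c; rewrite /= ?addn0.
Qed.

Lemma exp_count_lead c P x : exp_count c P (lead_exp gen_exp x).1 =
  (exp_count c P x.1 + \sum_p P (endpoint c p) * x.2 p)%N.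
Proof.
rewrite /lead_exp exp_countD (big_morph _ (@exp_countD c P) (exp_count0 c P)).
by congr (_ + _)%N; apply: eq_bigr => p _; rewrite exp_countMn exp_count_gen.
Qed.

Definition least_edge x p : Prop :=
  (0 < x.2 p)%N /\ forall q, (0 < x.2 q)%N -> (src p <= src q)%N /\ (tgt p <= tgt q)%N.

(** An edge minimizing [src + tgt] works: in a chain, it is then minimal in both coordinates. *)
Lemma ex_least_edge x : standard x -> mdeg x.2 != 0%N -> exists p, least_edge x p.
Proof.
move=> [_ chain]; rewrite mdegE sum_nat_eq0 => /forallPn[p0]; rewrite /= -lt0n => p00.
case: (arg_minnP (P := fun p => (0 < x.2 p)%N) (fun p => src p + tgt p)%N p00) => p p_gt0 pmin.
exists p; split=> // q q_gt0; have pq := pmin q q_gt0.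
have c1 := chain q p q_gt0 p_gt0; have c2 := chain p q p_gt0 q_gt0.
split; rewrite leqNgt; apply/negP => lt; first by have := c1 lt; lia.
by case: (ltngtP (src p) (src q)) => [/c2|/c1|E]; lia.
Qed.

(** Otherwise count the first-row variables in columns before [src q]: [y] has none, by
    compatibility with [q] and minimality of [q], but [p] contributes one to [x]. *)
Lemma least_src_le x y p q : standard y ->
    (lead_exp gen_exp x).1 = (lead_exp gen_exp y).1 ->
  least_edge x p -> least_edge y q -> (src q <= src p)%N.
Proof.
move=> [compat _] Exy [p0 _] [q0 qmin]; rewrite leqNgt; apply/negP => pq.
have := congr1 (exp_count 0 (fun i => (i < src q)%N)) Exy; rewrite !exp_count_lead.
have -> : exp_count 0 (fun i => (i < src q)%N) y.1 = 0%N.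
  apply: big1 => v /andP[/eqP v0 vq]; apply/eqP; rewrite -leqn0 leqNgt; apply/negP => yv.
  by have := compat v q yv q0; rewrite /compatible v0 /= leqNgt vq.
rewrite [in RHS]big1 => [|t _]; last first.
  have [->|] := posnP (y.2 t); first by rewrite muln0.
  by move=> /qmin[+ _]; rewrite leqNgt /endpoint /= => /negPf->.
rewrite (bigD1 p) //= -[endpoint 0 p]/(src p) pq mul1n addn0 => /eqP.
by rewrite !addn_eq0 (gtn_eqF p0) andbF.
Qed.

(** Otherwise count the second-row variables in columns from [tgt q] on. Every edge of [y]
    contributes. In [x] no matrix variable does, by compatibility with [p], nor does [p] itself, so
    the count is below the common y-degree. *)
Lemma least_tgt_le x y p q : standard x -> lead_exp gen_exp x = lead_exp gen_exp y ->
  least_edge x p -> least_edge y q -> (tgt q <= tgt p)%N.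
Proof.
move=> [compat _] Exy [p0 _] [q0 qmin]; rewrite leqNgt; apply/negP => pq.
have Edeg : mdeg x.2 = mdeg y.2 := congr1 snd Exy.
have := congr1 (fun z => exp_count 1 (fun i => (tgt q <= i)%N) z.1) Exy; rewrite !exp_count_lead.
have -> : exp_count 1 (fun i => (tgt q <= i)%N) x.1 = 0%N.
  apply: big1 => v /andP[/eqP v1 qv]; apply/eqP; rewrite -leqn0 leqNgt; apply/negP => xv.
  by have := compat v p xv p0; rewrite /compatible v1 /= leqNgt (leq_trans pq qv).
have -> : (\sum_t (tgt q <= endpoint 1%R t) * y.2 t = mdeg y.2)%N.
  rewrite mdegE; apply: eq_bigr => t _; have [->|] := posnP (y.2 t); first by rewrite muln0.
  by move=> /qmin[_]; rewrite /endpoint /= => ->; rewrite mul1n.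
have : (\sum_t (tgt q <= endpoint 1%R t) * x.2 t < mdeg x.2)%N.
  rewrite mdegE (bigD1 p) //= [X in (_ < X)%N](bigD1 p) //=.
  rewrite -[endpoint 1%R p]/(tgt p) [(tgt q <= tgt p)%N]leqNgt pq /=.
  rewrite mul0n add0n; apply: (@leq_ltn_trans (\sum_(t | t != p) x.2 t)).
    by apply: leq_sum => t _; rewrite -[leqRHS]mul1n leq_mul2r leq_b1 orbT.
  by rewrite -[X in (X < _)%N]add0n ltn_add2r.
by rewrite Edeg add0n => + E; rewrite E ltnNge leq_addl.
Qed.

(* By induction on the y-degree: the least edges of both monomials are equal, because
   their endpoints can be read off the leading monomial. *)
Lemma lead_exp_inj x y :
  standard x -> standard y -> lead_exp gen_exp x = lead_exp gen_exp y -> x = y.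
Proof.
move=> stdx stdy Exy; suff E2 : x.2 = y.2.
  move: (congr1 fst Exy) E2; rewrite /lead_exp /=.
  by case: (x) (y) => [a u] [b w] /= E1 E; rewrite -E in E1 *; rewrite (addIm E1).
have [d] := ubnP (mdeg x.2); elim: d x y stdx stdy Exy => // d IHd x y stdx stdy Exy.
rewrite ltnS => dx; have Edeg : mdeg x.2 = mdeg y.2 := congr1 snd Exy.
have [x0|x0] := eqVneq (mdeg x.2) 0%N.
  by move/eqP: (x0); rewrite Edeg mdeg_eq0 => /eqP->; apply/eqP; rewrite -mdeg_eq0 x0.
have [p pleast] := ex_least_edge stdx x0.
have [|q qleast] := ex_least_edge stdy; first by rewrite -Edeg.
have Epq : p = q.
  have Eyx := esym Exy.
  apply: edge_inj; apply/val_inj/eqP; rewrite eqn_leq.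
    rewrite (least_src_le stdx (congr1 fst Eyx) qleast pleast).
    by rewrite (least_src_le stdy (congr1 fst Exy) pleast qleast).
  by rewrite (least_tgt_le stdy Eyx qleast pleast) (least_tgt_le stdx Exy pleast qleast).
move: (pleast) (qleast) => [xp _] [yq _]; rewrite -Epq in yq.
(* Dividing both monomials by the common least variable keeps them standard and removes [gen_exp p]
   and one power of t from both leading monomials. *)
have stdB (z : mon) : standard z -> standard (z.1, (z.2 - U_(p))%MM).
  have sub t : (0 < (z.2 - U_(p))%MM t -> 0 < z.2 t)%N.
    by rewrite mnmBE => /leq_trans; apply; apply: leq_subr.
  move=> [compat chain]; split=> /= [v t v0 /sub|t t' /sub t0 /sub].
    exact: compat.
  exact: chain.
have leadB (z : mon) : (0 < z.2 p)%N -> lead_exp gen_exp z =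
    ((gen_exp p + (lead_exp gen_exp (z.1, (z.2 - U_(p))%MM)).1)%MM, (mdeg (z.2 - U_(p))%MM).+1).
  move=> zp; rewrite {1}/lead_exp; congr (_, _); last first.
    by rewrite {1}(mnm_decomp zp) mdegD mdeg1.
  rewrite /= [RHS]addmC -addmA; congr (_ + _)%MM.
  rewrite (bigD1 p) //= [in RHS](bigD1 p) //= [RHS]addmC addmA; congr (_ + _)%MM.
    by rewrite {1}(mnm_decomp zp) mnmDE mnm1E eqxx mulmS.
  apply: eq_bigr => t /negPf tp; congr (_ *+ _)%MM.
  by rewrite mnmBE mnm1E eq_sym tp subn0.
rewrite (mnm_decomp xp) (mnm_decomp yq); congr (_ + _)%MM.
apply: (IHd (x.1, _) (y.1, _)) => /=; try exact: stdB.
  move: Exy; rewrite (leadB x xp) (leadB y yq) => E.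
  rewrite [LHS]surjective_pairing [RHS]surjective_pairing; congr (_, _).
    exact: addmI (congr1 fst E).
  exact: succn_inj (congr1 snd E).
by apply: leq_trans dx; rewrite {2}(mnm_decomp xp) mdegD mdeg1.
Qed.

(** * The nonzero minors: minimality and leading monomials *)

Lemma gen_exp_dvd b p q : (b + gen_exp p)%MM = gen_exp q -> p = q.
Proof.
move=> E; have ep c : endpoint c q = endpoint c p.
  have := congr1 (exp_count c (pred1 (endpoint c p))) E.
  rewrite exp_countD !exp_count_gen /= eqxx addn1.
  by case: eqP => // _ /eqP; rewrite -lt0n.
by apply: edge_inj; [have := ep 0 | have := ep 1].
Qed.

(** The exponent [d] is that of the antidiagonal product, if nonzero. Dividing [gen_exp q] would
    force [src q = tgt p] and [tgt q = src p], against [src < tgt]. *)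
Lemma genP p : gen p = 'X_[gen_exp p] \/
  exists2 d, gen p = 'X_[gen_exp p] - 'X_[d] & forall b q, (b + d)%MM <> gen_exp q.
Proof.
have E : gen p = 'X_[gen_exp p] - X 0 (tgt p) * X 1 (src p).
  rewrite /gen minorE [X 0 (src p)]entryE [X 1 (tgt p)]entryE.
  by rewrite sparse_var_src sparse_var_tgt mpolyXD.
have [t0|] := boolP (isSome (sparse_var r s 0 (tgt p))); last first.
  by move/negPf=> t0; left; rewrite E entryE t0 mul0r subr0.
have [s1|] := boolP (isSome (sparse_var r s 1 (src p))); last first.
  by move/negPf=> s1; left; rewrite E [X 1 _]entryE s1 mulr0 subr0.
right; exists (entry_exp 0%R (tgt p) + entry_exp 1%R (src p))%MM.
  by rewrite E !entryE t0 s1 mpolyXD.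
move=> b q Eq; have := congr1 (exp_count 0 (pred1 (tgt p))) Eq.
have := congr1 (exp_count 1 (pred1 (src p))) Eq.
rewrite !exp_count_gen !exp_countD !exp_count_entry //= !eqxx /endpoint /=.
case: eqP => [tq|_]; last by rewrite addnC.
case: eqP => [sq _ _|_ _]; last by rewrite addnC.
have [st _ _] := edgeP p; have [+ _ _] := edgeP q.
by rewrite tq sq ltnNge ltnW.
Qed.

(** No monomial of [gen q] divides [gen_exp p]. So the coefficient at [gen_exp p] separates [gen p]
    from the ideal of the other minors. *)
Lemma mcoeff_mul_gen (a : R) p q : q != p -> (a * gen q)@_(gen_exp p) = 0.
Proof.
move=> qp; rewrite mcoeffM_msupp; apply: big1 => b _; rewrite big_seq; apply: big1 => d.
rewrite mcoeff_msupp => qd; case: eqP => [E|_]; last by rewrite mulr0.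
case/eqP: qp; case: (genP q) qd => [->|[d' -> d'P]]; rewrite ?mcoeffB !mcoeffX.
  by have [Ed _|_] := eqVneq (gen_exp q) d; [apply: (@gen_exp_dvd b); rewrite Ed | rewrite eqxx].
have [Ed _|_] := eqVneq (gen_exp q) d; first by apply: (@gen_exp_dvd b); rewrite Ed.
by have [Ed _|_] := eqVneq d' d; [case: (d'P b p); rewrite Ed | rewrite subrr eqxx].
Qed.

Lemma mcoeff_gen p : (gen p)@_(gen_exp p) = 1.
Proof.
case: (genP p) => [->|[d -> dP]]; rewrite ?mcoeffB !mcoeffX eqxx //.
by case: eqP => [E|_]; [case: (dP 0%MM p); rewrite add0m E | rewrite subr0].
Qed.

Lemma gen_neq0 p : gen p != 0.
Proof. by apply: contra_eq_neq (mcoeff_gen p) => ->; rewrite mcoeff0 eq_sym oner_neq0. Qed.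

Lemma gen_lead le p : diagonal_order X le -> monic_lead le (gen p) (gen_exp p).
Proof.
move=> /(_ 2%N id (fun b : 'I_2 => if b == 0 then src p else tgt p)) diag.
have [|||d [dp led] E] := diag; [by []| |exact: gen_neq0|].
  move=> a b; have [->|->] := ord2P a; have [->|->] := ord2P b => //= _.
  by case: (edgeP p).
rewrite -!/(gen p) in dp led E; suff Ed : d = gen_exp p.
  by split; [apply: mcoeff_gen | rewrite -Ed => b; rewrite -mcoeff_msupp; apply: led].
(* The diagonal product has coefficient 1 at [gen_exp p], so the leading exponent [d] must be
   [gen_exp p]. *)
apply/eqP; have := congr1 (mcoeff (gen_exp p)) E.
rewrite !big_ord_recl big_ord0 mulr1 /= !entryE sparse_var_src sparse_var_tgt -mpolyXD.
rewrite mcoeffZ !mcoeffX eqxx; case: eqP => // _ /eqP.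
by rewrite mulr0 eq_sym oner_eq0.
Qed.

Lemma minors_idealE f :
  minors_ideal K n r s f <-> ideal_gen (fun g => exists p, g = gen p) f.
Proof.
split; apply: ideal_gen_sub => g.
  move=> [i [j [ij ->]]]; have [e_ij|] := boolP (edge (i, j)); last first.
    by move/(minor_eq0 ij)->; apply: ideal_gen0.
  apply: mem_ideal_gen; case: (edge_varP i j) => [p <- <-|]; first by exists p.
  by rewrite e_ij.
move=> [p ->]; apply: mem_ideal_gen; exists (src p), (tgt p).
by split=> //; case: (edgeP p).
Qed.

Lemma gen_minimal : minimal_generators (minors_ideal K n r s) gen.
Proof.
split=> [f|p genp]; first exact: minors_idealE.
have : (gen p)@_(gen_exp p) = 0; last by rewrite mcoeff_gen => /eqP; rewrite oner_eq0.
move: (gen p) genp; apply: (ideal_gen_ind (P := fun f : R => f@_(gen_exp p) = 0)).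
- by rewrite mcoeff0.
- by move=> f g f0 g0; rewrite mcoeffD f0 g0 addr0.
by move=> a _ [q qp ->]; apply: mcoeff_mul_gen.
Qed.

Lemma ex_edge i j : edge (i, j) -> exists2 p, src p = i & tgt p = j.
Proof. by case: (edge_varP i j) => [p si tj _|/negPf->//]; exists p. Qed.

(** Counting from 0, [(0, n - 1)] is an edge; the other is [(0, r)] if [r < n - 1], and [(1, n - 1)]
    if not. *)
Lemma ex_two_edges : (2 < n)%N -> (0 < r)%N -> (r < n)%N -> exists p q, p != q.
Proof.
move=> n2 r0 rn; have n1 : (n.-1 < n)%N by lia.
have [|p sp tp] := @ex_edge (Ordinal (ltnW (ltnW n2))) (Ordinal n1); first by rewrite /edge /=; lia.
have [rn1|rn1] := ltnP r n.-1.
  have [|q sq tq] := @ex_edge (Ordinal (ltnW (ltnW n2))) (Ordinal rn).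
    by rewrite /edge /=; lia.
  exists p, q; apply/eqP => E; move: tq; rewrite -E tp => /(congr1 val) /=; lia.
have [|q sq tq] := @ex_edge (Ordinal (ltnW n2)) (Ordinal n1); first by rewrite /edge /=; lia.
by exists p, q; apply/eqP => E; move: sq; rewrite -E sp => /(congr1 val).
Qed.

(** * Relation type, initial algebra and SAGBI basis *)

Variable le : rel 'X_{1..N}.
Hypotheses (hle : term_order le) (hdiag : diagonal_order X le).

Lemma gen_kernel F : rees_map gen F = 0 -> ideal_gen (fun F => exists t, F = relation t) F.
Proof.
apply: (kernel_gen (w := weight) hle (fun p => gen_lead p hdiag) lead_exp_inj) => [_ [t ->]|].
  exact: rees_map_relation.
exact: reduction.
Qed.

Lemma reltype_minors_le2 : (2 < n)%N -> (0 < r)%N -> (r < n)%N ->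
  exists2 d, is_reltype (minors_ideal K n r s) d & (d <= 2)%N.
Proof.
move=> n2 r0 rn; pose g (k : 'I_#|{: relation_index}|) := relation (enum_val k).
apply: (is_reltype_le _ gen_minimal (g := g)) => //.
- move=> F; split=> [/gen_kernel|].
    apply: ideal_gen_sub => _ [t ->]; apply: mem_ideal_gen.
    by exists (enum_rank t); rewrite /g enum_rankK.
  by apply: rees_map_ideal => _ [k ->]; apply: rees_map_relation.
- by move=> k; apply: relation_homog.
have [p [q pq]] := ex_two_edges n2 r0 rn.
(* The Koszul relation of two distinct minors is a nonzero element of the kernel. *)
exists (gen p *: 'X_q - gen q *: 'X_p).
  rewrite /rees_map mmapB !mmapZ !mmapX !mmap1U.
  by rewrite !mul_polyC !scalerA [gen q * _]mulrC subrr.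
apply/eqP => /(congr1 (mcoeff U_(q)%MM))/eqP.
rewrite mcoeffB !mcoeffZ !mcoeffX mcoeff0 eqxx eq_mnm1 (negPf pq) mulr1 mulr0 subr0.
by rewrite (negPf (gen_neq0 p)).
Qed.

(** The leading monomials of the nonzero elements of [sparse_sagbi]. *)
Definition monomial_generators (f : {poly R}) : Prop :=
  (exists v, f = ('X_v : R)%:P) \/ (exists p, f = 'X_[gen_exp p] *: 'X).

Lemma rees_gen f : rees (minors_ideal K n r s) f -> exists F, rees_map gen F = f.
Proof.
apply: (rees_ind (P := fun f => exists F, rees_map gen F = f)).
- by move=> a; exists a%:MP; rewrite /rees_map mmapC.
- move=> _ [i [j [ij ->]]]; exists (edge_var i j); exact: rees_map_edge_var.
- by move=> _ _ [F <-] [F' <-]; exists (F + F'); rewrite /rees_map mmapD.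
by move=> _ _ [F <-] [F' <-]; exists (F * F'); rewrite /rees_map rmorphM.
Qed.

(** Every leading monomial is the [lead_exp] of a standard monomial, and this factors into the
    listed generators. Both the initial algebra and the SAGBI basis follow from it. *)
Lemma initial_rees_sub f : initial_monomials le (rees (minors_ideal K n r s)) f ->
  alg_gen monomial_generators f.
Proof.
move=> [_ [a [/rees_gen[F <-] leadF ->]]].
have [x _ ->] : exists2 x, standard x & a = lead_exp gen_exp x.
  apply: (lead_in_image (w := weight) (G := fun F => exists t, F = relation t) hle
    (fun p => gen_lead p hdiag) lead_exp_inj) leadF.
    by move=> _ [t ->]; apply: rees_map_relation.
  exact: reduction.
have -> : 'X_[(lead_exp gen_exp x).1] *: 'X^((lead_exp gen_exp x).2) =
    ('X_[x.1] : R)%:P * \prod_p ('X_[gen_exp p] *: 'X) ^+ x.2 p :> {poly R}.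
  rewrite /lead_exp /= mpolyXD mul_polyC -scalerA; congr (_ *: _).
  rewrite (big_morph _ (@mpolyXD N K) (@mpolyX0 N K)) mdegE -prodrXr -mul_polyC rmorph_prod.
  rewrite -big_split; apply: eq_bigr => p _ /=.
  by rewrite -mpolyXn exprZn -mul_polyC.
apply: alg_gen_mul; first by apply: alg_genC => v; apply: alg_gen_in; left; exists v.
by apply: alg_gen_prod => p; apply/alg_genX/alg_gen_in; right; exists p.
Qed.

Lemma initial_monomial_var (C : {poly R} -> Prop) v :
  C ('X_v : R)%:P -> initial_monomials le C ('X_v : R)%:P.
Proof.
move=> Cv; exists ('X_v : R)%:P, (U_(v)%MM, 0%N); split=> //.
  exact/is_lead_extC/monic_lead_is_lead/monic_leadX.
by rewrite /= expr0 alg_polyC.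
Qed.

(** One inclusion is [initial_rees_sub]. For the other, the leading monomial of [g] times t is that
    of [g *: 'X]. *)
Lemma initial_algebra_rees f :
  initial_algebra le (rees (minors_ideal K n r s)) f <->
  rees (initial_ideal le (minors_ideal K n r s)) f.
Proof.
split.
  apply: rees_alg_gen => g /initial_rees_sub; apply: rees_alg_gen => _ [[v ->]|[p ->]].
    exact: reesC.
  apply/rees_genX/mem_ideal_gen; exists (gen p), (gen_exp p); split=> //.
    by apply/minors_idealE/mem_ideal_gen; exists p.
  exact/monic_lead_is_lead/gen_lead.
apply: rees_ind => [a|_ [g [a [Ig lead_g ->]]]|g g'|g g'].
- apply: alg_genC => v; apply/alg_gen_in/initial_monomial_var; exact: reesC.
- apply: alg_gen_in; exists (g *: 'X), (a, 1%N); split=> //; first exact: rees_genX.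
  exact: is_lead_ext_scaleX.
- exact: alg_gen_add.
exact: alg_gen_mul.
Qed.

Lemma sagbi_rees : sagbi_basis le (rees (minors_ideal K n r s)) (sparse_sagbi K n r s).
Proof.
have subC f : sparse_sagbi K n r s f -> rees (minors_ideal K n r s) f.
  case=> [[i _ ->]|[j _ ->]|[i [j [ij ->]]]]; try exact: reesC.
  by apply/rees_genX/mem_ideal_gen; exists i, j.
split=> // f; split; last first.
  apply: alg_gen_sub => g [h [a [Ch lead_h ->]]]; apply: alg_gen_in.
  by exists h, a; split=> //; apply: subC.
apply: alg_gen_sub => g /initial_rees_sub; apply: alg_gen_sub => _ [[v ->]|[p ->]].
  (* Each indeterminate is an entry of the matrix, and its row decides which of the two lists of
     variables contains it. *)
  apply/alg_gen_in/initial_monomial_var; rewrite -entry_var.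
  have: isSome (sparse_var r s (var_row v) (var_col v)) by rewrite sparse_varK.
  have [->|->] := ord2P (var_row v).
    by rewrite sparse_var0 => ?; apply: Or31; exists (var_col v).
  by rewrite sparse_var1 => ?; apply: Or32; exists (var_col v).
apply: alg_gen_in; exists (gen p *: 'X), (gen_exp p, 1%N); split=> //.
  by apply: Or33; exists (src p), (tgt p); split=> //; case: (edgeP p).
exact/is_lead_ext_scaleX/monic_lead_is_lead/gen_lead.
Qed.

End Sparse.

Theorem theorem3p3 (K : fieldType) (n r s : nat)
    (hn : (3 <= n)%N) (hr : (1 <= r)%N)
    (hrs : (r + s <= n)%N) (hnr : (n - r - s <= r)%N) (hrn : (r < n)%N)
    (le : rel 'X_{1..sparse_vars n r s})
    (hle : term_order le) (hdiag : diagonal_order (sparse_mx K n r s) le) :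
  [/\ forall p : {poly {mpoly K[sparse_vars n r s]}},
        initial_algebra le (rees (minors_ideal K n r s)) p
        <-> rees (initial_ideal le (minors_ideal K n r s)) p,
      exists2 d, is_reltype (minors_ideal K n r s) d & (d <= 2)%N
    & sagbi_basis le (rees (minors_ideal K n r s)) (sparse_sagbi K n r s)].
Proof.
split; first exact: initial_algebra_rees.
  exact: (reltype_minors_le2 hrs hle hdiag).
exact: sagbi_rees.
Qed.
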